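(* Let $t$ be a selfadjoint regular Fredholm operator on a Hilbert $C^*$-module $E$ and let $\lambda\mapsto A_\lambda$ be a continuous path (parametrized by a real interval) of selfadjoint bounded adjointable operators on $E$ with respect to the norm topology. Suppose that each $A_\lambda$ is $t$-compact. Then $\lambda\mapsto t+A_\lambda$ is a continuous path of selfadjoint regular Fredholm operators with respect to the gap metric.
   Context: For a Hilbert $C^*$-module $E$, $L(E)$ denotes the bounded adjointable operators on $E$ and $K(E)$ the compact operators on $E$ (the norm closure of the linear span of the operators $z\mapsto x\langle y,z\rangle$, $x,y\in E$); compact operators between two Hilbert $C^*$-modules over the same algebra are defined analogously. A closed densely defined operator $t:D(t)\subseteq E\to E$ with densely defined adjoint $t^*$ is called regular if $I+t^*t$ has dense range. A regular operator $t$ is selfadjoint if $t=t^*$. A regular operator $t$ is Fredholm if it has a pseudo left inverse and a pseudo right inverse. Here $G\in L(E)$ is a pseudo left inverse of $t$ if $Gt$ is closable, its closure $\overline{Gt}$ lies in $L(E)$, and $\overline{Gt}\equiv 1 \bmod K(E)$; and $G\in L(E)$ is a pseudo right inverse of $t$ if $tG$ is closable, $\overline{tG}\in L(E)$, and $\overline{tG}\equiv 1\bmod K(E)$. Relative compactness: for a regular operator $t$ on $E$, $E(t)$ denotes $D(t)$ regarded as a Hilbert $C^*$-module with inner product $\langle x,y\rangle_t=\langle x,y\rangle+\langle t(x),t(y)\rangle$. If $t,s$ are regular operators on $E$ with $D(t)\subseteq D(s)$, then $s$ is called $t$-compact if $s:E(t)\to E$ (the restriction of $s$ to $D(t)$)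 is a compact operator between Hilbert $C^*$-modules. Bounded adjointable operators are regular with domain $E$, and $t+A_\lambda$ has domain $D(t)$. Gap metric: for a regular operator $t$ on $E$, the graph $G(t)=\{(x,t(x)):x\in D(t)\}$ is orthogonally complemented in $E\oplus E$; let $P_{G(t)}$ be the orthogonal projection onto it. For regular operators $t,s$ on $E$, the gap metric is $g(t,s)=\|P_{G(t)}-P_{G(s)}\|$. *)

(* Defs.v *)
From HB Require Import structures.
From mathcomp Require Import all_boot all_order all_algebra.
From mathcomp Require Import all_classical all_reals all_analysis.
From mathcomp Require Import complex.

Set Implicit Arguments.
Unset Strict Implicit.
Unset Printing Implicit Defensive.

Import Order.TTheory GRing.Theory Num.Theory.
Import numFieldNormedType.Exports.

Local Open Scope classical_set_scope.
Local Open Scope ring_scope.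

(* C*-algebras are complex and not assumed to be unital, so the product cannot
   be the one of a MathComp ring. *)
HB.mixin Record CompleteNormedModule_isCStarAlgebra (R : realType) A
    of CompleteNormedModule R[i] A := {
  cmul : A -> A -> A;
  cstar : A -> A;
  cmulA : associative cmul;
  cmulDl : left_distributive cmul +%R;
  cmulDr : right_distributive cmul +%R;
  cscaleAl : forall (k : R[i]) (a b : A), k *: cmul a b = cmul (k *: a) b;
  cscaleAr : forall (k : R[i]) (a b : A), k *: cmul a b = cmul a (k *: b);
  cnormM : forall a b : A, `|cmul a b| <= `|a| * `|b|;
  cstarK : involutive cstar;
  cstarD : {morph cstar : a b / a + b};
  cstarZ : forall (k : R[i]) (a : A), cstar (k *: a) = conjc k *: cstar a;
  cstarM : forall a b : A, cstar (cmul a b) = cmul (cstar b) (cstar a);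
  cstar_norm : forall a : A, `|cmul (cstar a) a| = `|a| ^+ 2
}.

#[short(type="cstarAlgType")]
HB.structure Definition CStarAlgebra (R : realType) :=
  {A of CompleteNormedModule_isCStarAlgebra R A & CompleteNormedModule R[i] A}.

(* A complex vector space with a compatible right action of A and an A-valued
   hermitian form, conjugate linear in its first argument. The axioms that make
   it a Hilbert C*-module (positivity, norm, completeness) are kept apart in
   hilbertModType, so that E (+) E and E(t) below get their inner products
   without first proving these axioms for them. *)
HB.mixin Record Lmodule_isInnerProductModule (R : realType)
    (A : cstarAlgType R) E of GRing.Lmodule R[i] E := {
  ract : E -> A -> E;
  iprod : E -> E -> A;
  ractDl : forall (x y : E) (a : A), ract (x + y) a = ract x a + ract y a;
  ractDr : forall (x : E) (a b : A), ract x (a + b) = ract x a + ract x b;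
  ractA : forall (x : E) (a b : A), ract x (cmul a b) = ract (ract x a) b;
  ractZl : forall (k : R[i]) (x : E) (a : A),
    ract (k *: x) a = k *: ract x a;
  ractZr : forall (k : R[i]) (x : E) (a : A),
    ract x (k *: a) = k *: ract x a;
  iprodDr : forall x y z : E, iprod x (y + z) = iprod x y + iprod x z;
  iprodZr : forall (k : R[i]) (x y : E), iprod x (k *: y) = k *: iprod x y;
  iprod_ract : forall (x y : E) (a : A),
    iprod x (ract y a) = cmul (iprod x y) a;
  iprodC : forall x y : E, cstar (iprod x y) = iprod y x
}.

#[short(type="innerProductModType")]
HB.structure Definition InnerProductModule (R : realType)
    (A : cstarAlgType R) :=
  {E of Lmodule_isInnerProductModule R A E & GRing.Lmodule R[i] E}.

(* iprod_normE says that the norm for which E is complete is the one given by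
   the inner product; it also makes the inner product definite. An element of
   a C*-algebra is positive when it is of the form b^* b. *)
HB.mixin Record InnerProductModule_isHilbert (R : realType)
    (A : cstarAlgType R) E
    of InnerProductModule R A E & CompleteNormedModule R[i] E := {
  iprod_ge0 : forall x : E,
    exists b : A, iprod x x = cmul (cstar b) b;
  iprod_normE : forall x : E, `|x| ^+ 2 = `|iprod x x : A|
}.

#[short(type="hilbertModType")]
HB.structure Definition HilbertModule (R : realType) (A : cstarAlgType R) :=
  {E of InnerProductModule_isHilbert R A E & InnerProductModule R A E
      & CompleteNormedModule R[i] E}.

Section InnerProductModuleTheory.
Context {R : realType} {A : cstarAlgType R}.
Implicit Types E F : innerProductModType A.

Definition ipnorm E (x : E) : R := Num.sqrt (complex.Re `|iprod x x : A|).

Definition opnorm E F (T : E -> F) : R :=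
  sup [set ipnorm (T x) | x in [set x : E | ipnorm x <= 1]].

Definition compact_op E F (T : E -> F) : Prop :=
  forall e : R, 0 < e -> exists s : seq (F * E), forall z : E,
    ipnorm (T z - \sum_(p <- s) ract p.1 (iprod p.2 z : A)) <= e * ipnorm z.

Record adjointable E F := Adjointable {
  adjointable_fun :> {linear E -> F};
  adjointable_ract : forall (x : E) (a : A),
    adjointable_fun (ract x a) = ract (adjointable_fun x) a;
  adjointable_bounded : exists c : R, forall x : E,
    ipnorm (adjointable_fun x) <= c * ipnorm x;
  adjointable_adjoint : exists S : F -> E, forall (x : E) (y : F),
    iprod (adjointable_fun x) y = iprod x (S y) :> A
}.

Definition selfadjoint_bounded E (T : adjointable E E) : Prop :=
  forall x y : E, iprod (T x) y = iprod x (T y) :> A.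

End InnerProductModuleTheory.

Section DirectSum.
Context {R : realType} {A : cstarAlgType R} (E F : innerProductModType A).

Let act (p : E * F) (a : A) : E * F := (ract p.1 a, ract p.2 a).
Let ip (p q : E * F) : A := iprod p.1 q.1 + iprod p.2 q.2.

Let actDl (p q : E * F) (a : A) : act (p + q) a = act p a + act q a.
Proof. by rewrite /act !ractDl. Qed.
Let actDr (p : E * F) (a b : A) : act p (a + b) = act p a + act p b.
Proof. by rewrite /act !ractDr. Qed.
Let actA (p : E * F) (a b : A) : act p (cmul a b) = act (act p a) b.
Proof. by rewrite /act !ractA. Qed.
Let actZl (k : R[i]) (p : E * F) (a : A) : act (k *: p) a = k *: act p a.
Proof. by rewrite /act !ractZl. Qed.
Let actZr (k : R[i]) (p : E * F) (a : A) : act p (k *: a) = k *: act p a.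
Proof. by rewrite /act !ractZr. Qed.
Let ipDr (p q r : E * F) : ip p (q + r) = ip p q + ip p r.
Proof. by rewrite /ip !iprodDr addrACA. Qed.
Let ipZr (k : R[i]) (p q : E * F) : ip p (k *: q) = k *: ip p q.
Proof. by rewrite /ip !iprodZr scalerDr. Qed.
Let ip_act (p q : E * F) (a : A) : ip p (act q a) = cmul (ip p q) a.
Proof. by rewrite /ip !iprod_ract cmulDl. Qed.
Let ipC (p q : E * F) : cstar (ip p q) = ip q p.
Proof. by rewrite /ip cstarD !iprodC. Qed.

HB.instance Definition _ :=
  Lmodule_isInnerProductModule.Build R A (E * F)%type
    actDl actDr actA actZl actZr ipDr ipZr ip_act ipC.

End DirectSum.

Section Operators.
Context {R : realType} {A : cstarAlgType R} {E : hilbertModType A}.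

Definition subdom (D : submodClosed E) := {x : E | x \in D}.

HB.instance Definition _ (D : submodClosed E) := SubChoice.on (subdom D).
HB.instance Definition _ (D : submodClosed E) :=
  [SubChoice_isSubLmodule of subdom D by <:].

(* An unbounded operator t : D(t) -> E is linear over the complex numbers and
   over A; D(t) is a complex subspace of E that is stable under A. *)
Record operator := Operator {
  dom : submodClosed E;
  opfun :> {linear subdom dom -> E};
  dom_ract : forall (x : E) (a : A), x \in dom -> ract x a \in dom;
  opfun_ract : forall (x y : subdom dom) (a : A),
    \val y = ract (\val x) a -> opfun y = ract (opfun x) a
}.

End Operators.
Arguments operator {R A} E.

Section GraphModule.
Context {R : realType} {A : cstarAlgType R} {E : hilbertModType A}.

(* E(t), with <x, y>_t = <x, y> + <t x, t y>. *)
Definition graph_module (t : operator E) := subdom (dom t).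

Variable t : operator E.

HB.instance Definition _ := GRing.Lmodule.on (graph_module t).

Let act (x : graph_module t) (a : A) : graph_module t :=
  exist _ (ract (\val x) a) (dom_ract a (valP x)).
Let ip (x y : graph_module t) : A :=
  iprod (\val x) (\val y) + iprod (t x) (t y).

Let actDl (x y : graph_module t) (a : A) : act (x + y) a = act x a + act y a.
Proof. by apply: val_inj; rewrite /= ractDl. Qed.
Let actDr (x : graph_module t) (a b : A) : act x (a + b) = act x a + act x b.
Proof. by apply: val_inj; rewrite /= ractDr. Qed.
Let actA (x : graph_module t) (a b : A) :
  act x (cmul a b) = act (act x a) b.
Proof. by apply: val_inj; rewrite /= ractA. Qed.
Let actZl (k : R[i]) (x : graph_module t) (a : A) :
  act (k *: x) a = k *: act x a.
Proof. by apply: val_inj; rewrite /= ractZl. Qed.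
Let actZr (k : R[i]) (x : graph_module t) (a : A) :
  act x (k *: a) = k *: act x a.
Proof. by apply: val_inj; rewrite /= ractZr. Qed.
Let ipDr (x y z : graph_module t) : ip x (y + z) = ip x y + ip x z.
Proof. by rewrite /ip /= linearD !iprodDr addrACA. Qed.
Let ipZr (k : R[i]) (x y : graph_module t) : ip x (k *: y) = k *: ip x y.
Proof. by rewrite /ip /= linearZ /= !iprodZr scalerDr. Qed.
Let ip_act (x y : graph_module t) (a : A) :
  ip x (act y a) = cmul (ip x y) a.
Proof.
by rewrite /ip (@opfun_ract _ _ _ t y (act y a) a)//= !iprod_ract cmulDl.
Qed.
Let ipC (x y : graph_module t) : cstar (ip x y) = ip y x.
Proof. by rewrite /ip cstarD !iprodC. Qed.

HB.instance Definition _ :=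
  Lmodule_isInnerProductModule.Build R A (graph_module t)
    actDl actDr actA actZl actZr ipDr ipZr ip_act ipC.

End GraphModule.

Section BoundedOperators.
Context {R : realType} {A : cstarAlgType R} {E : hilbertModType A}.

Definition full_dom : {pred E} := predT.

Let full_dom_closed : submod_closed full_dom.
Proof. by []. Qed.

HB.instance Definition _ :=
  GRing.isSubmodClosed.Build R[i] E full_dom full_dom_closed.

Section Full.
Variable T : adjointable E E.

Let full_fun : {linear subdom full_dom -> E} := T \o \val.

Let full_dom_ract (x : E) (a : A) : x \in full_dom -> ract x a \in full_dom.
Proof. by []. Qed.

Let full_fun_ract (x y : subdom full_dom) (a : A) :
  \val y = ract (\val x) a -> full_fun y = ract (full_fun x) a.
Proof. by move=> /= ->; exact: adjointable_ract. Qed.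

Definition bounded_operator : operator E := Operator full_dom_ract full_fun_ract.

End Full.

Section Sum.
Variables (t : operator E) (T : adjointable E E).

Let add_fun : {linear subdom (dom t) -> E} := t \+ (T \o \val).

Let add_fun_ract (x y : subdom (dom t)) (a : A) :
  \val y = ract (\val x) a -> add_fun y = ract (add_fun x) a.
Proof.
move=> yxa; rewrite /add_fun /= (opfun_ract yxa) ractDl; congr (_ + _).
by rewrite yxa adjointable_ract.
Qed.

(* t + T, with domain D(t). *)
Definition add_bounded : operator E := Operator (@dom_ract _ _ _ t) add_fun_ract.

End Sum.

End BoundedOperators.

Section Regular.
Context {R : realType} {A : cstarAlgType R} {E : hilbertModType A}.
Implicit Types (t s : operator E) (G T : adjointable E E) (S : set (E * E)).

Definition graph t : set (E * E) := range (fun x : subdom (dom t) => (\val x, t x)).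

(* The graph of t^* when S is the graph of a densely defined t. *)
Definition adjoint_graph S : set (E * E) :=
  [set p | forall q, S q -> iprod q.2 p.1 = iprod q.1 p.2 :> A].

(* The composite relation S' \; S applies S first. The last clause says that
   1 + t^* t has dense range. *)
Definition regular t : Prop :=
  [/\ closed (graph t), dense (fst @` graph t),
      dense (fst @` adjoint_graph (graph t)) &
      dense [set p.1 + p.2 | p in (adjoint_graph (graph t) \; graph t)%relation]].

Definition selfadjoint t : Prop := graph t = adjoint_graph (graph t).

Definition closable S : Prop := forall y : E, closure S (0, y) -> y = 0.

(* The operator with graph S is closable, and its closure belongs to L(E) and
   is congruent to 1 modulo K(E). *)
Definition closure_eq1_mod_compact S : Prop :=
  closable S /\ exists B : adjointable E E,
    closure S = graph (bounded_operator B) /\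
    compact_op (fun x : E => B x - x).

Definition pseudo_left_inverse t G : Prop :=
  closure_eq1_mod_compact (graph (bounded_operator G) \; graph t)%relation.

Definition pseudo_right_inverse t G : Prop :=
  closure_eq1_mod_compact (graph t \; graph (bounded_operator G))%relation.

Definition fredholm t : Prop :=
  (exists G, pseudo_left_inverse t G) /\ (exists G, pseudo_right_inverse t G).

Definition restrict_dom t s (sub : {subset dom t <= dom s})
    (x : graph_module t) : subdom (dom s) :=
  exist _ (\val x) (sub _ (valP x)).

(* s is t-compact. *)
Definition relatively_compact t s : Prop :=
  exists sub : {subset dom t <= dom s},
    compact_op (fun x : graph_module t => s (restrict_dom sub x)).

(* For a closed submodule S that is orthogonally complemented in E (+) E, this
   is the orthogonal projection onto S. *)
Definition orth_proj S (p : E * E) : E * E :=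
  xget 0 [set q | S q /\ forall r, S r -> iprod r (p - q) = 0 :> A].

Definition gap t s : R :=
  opnorm (fun p : E * E => orth_proj (graph t) p - orth_proj (graph s) p).

End Regular.

(* Main.v *)
Require Import Defs.
From HB Require Import structures.
From mathcomp Require Import all_boot all_order all_algebra.
From mathcomp Require Import all_classical all_reals all_analysis.
From mathcomp Require Import complex.
From mathcomp Require Import ring lra.

Import Order.TTheory GRing.Theory Num.Theory.
Import numFieldNormedType.Exports.

Local Open Scope classical_set_scope.
Local Open Scope ring_scope.

Set Implicit Arguments.
Unset Strict Implicit.
Unset Printing Implicit Defensive.

(** For a selfadjoint regular t the operators t + i and t - i are onto, since
    the range of t + k, where k = i or - i, contains the dense range of
    1 + t^* t = (t + k) (t - k) and is closed by
    <(t + k) x, (t + k) x> = <t x, t x> + <x, x>. Conversely this surjectivity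
    makes a selfadjoint operator regular. Adding a bounded selfadjoint T keeps
    selfadjointness (sa_graph_plus), and keeps the surjectivity when the norm
    of T is at most 1/2, by a Neumann series; a general T is added in small
    pieces (shift_onto_plus, regular_add_bounded).

    The projection onto the graph of t is an explicit combination of (t + i)^-1
    and (t - i)^-1 (orth_proj_resolvents), so the resolvent identity bounds the
    gap of t + T and t + U by four times the norm of T - U
    (gap_add_bounded_le), which gives the continuity of the path.

    The operator t is Fredholm exactly when the bounded operator t (t + i)^-1 is
    invertible modulo compacts: pseudo inverses G of t yield inverses
    Q = 1 + i G of it. The operators Q (t + i)^-1 and (t + i)^-1 Q are then better pseudo
    inverses of t than G, because their products with a t-compact T are compact:
    T (t + i)^-1 is compact as E -> E(t) -> E, and (t + i)^-1 T is the adjoint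
    of T (t - i)^-1 (fredholm_add_bounded).

    All the estimates rest on one fact about the C*-algebra A: the norm of a^* a
    is at most that of a^* a + b^* b (nrm_star_sq_le); the Cauchy-Schwarz
    inequality is also a consequence. It amounts to the theorem that a^* a is
    positive, which is proved in the unital algebra of multipliers of A without
    spectral theory. Square roots of 1 - x are obtained from the iteration
    y = (x + y ^ 2) / 2 (one_sub_root), which makes the squares of selfadjoint
    elements a convex cone on which the norm is monotone (mposD, mpos_le_bd),
    and a boundedness argument replaces the comparison of the spectra of T^* T and
    T T^* (star_sq_neg_eq0, star_sq_pos). *)

(** * Linear combinations and real-valued norms *)

Section LinearExpressions.
Context {K : pzRingType} {V : lmodType K}.

Inductive linexp :=
  | LVar of nat
  | LZero
  | LAdd of linexp & linexp
  | LOpp of linexp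
  | LScale of K & linexp.

Fixpoint lin_eval (env : seq V) (e : linexp) : V :=
  match e with
  | LVar i => nth 0 env i
  | LZero => 0
  | LAdd e1 e2 => lin_eval env e1 + lin_eval env e2
  | LOpp e1 => - lin_eval env e1
  | LScale k e1 => k *: lin_eval env e1
  end.

Fixpoint lin_coef (e : linexp) (i : nat) : K :=
  match e with
  | LVar j => if Nat.eqb i j then 1 else 0
  | LZero => 0
  | LAdd e1 e2 => lin_coef e1 i + lin_coef e2 i
  | LOpp e1 => - lin_coef e1 i
  | LScale k e1 => k * lin_coef e1 i
  end.

Lemma lin_evalE env e :
  lin_eval env e = \sum_(i < size env) lin_coef e i *: nth 0 env i.
Proof.
elim: e => /= [j||e1 -> e2 ->|e ->|k e ->].
- have [js|sj] := ltnP j (size env).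
    rewrite (bigD1 (Ordinal js))//= PeanoNat.Nat.eqb_refl scale1r big1 ?addr0//.
    move=> i /eqP ij; case: PeanoNat.Nat.eqb_spec => [ji|_].
      by case: ij; apply: val_inj.
    by rewrite scale0r.
  rewrite nth_default// big1// => i _; case: PeanoNat.Nat.eqb_spec => [ij|_].
    by move: sj; rewrite -ij leqNgt ltn_ord.
  by rewrite scale0r.
- by rewrite big1// => i _; rewrite scale0r.
- by rewrite -big_split; apply: eq_bigr => i _; rewrite scalerDl.
- by rewrite -sumrN; apply: eq_bigr => i _; rewrite scaleNr.
- by rewrite scaler_sumr; apply: eq_bigr => i _; rewrite scalerA.
Qed.

Fixpoint lin_coefs_eq (e1 e2 : linexp) (n : nat) : Prop :=
  if n is n'.+1 then lin_coef e1 n' = lin_coef e2 n' /\ lin_coefs_eq e1 e2 n'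
  else True.

Lemma lin_eval_eq env e1 e2 :
  lin_coefs_eq e1 e2 (size env) -> lin_eval env e1 = lin_eval env e2.
Proof.
move=> h; rewrite !lin_evalE; apply: eq_bigr => -[i /= ip] _; congr (_ *: _).
elim: (size env) h ip => //= n IH [e12 h]; rewrite ltnS leq_eqVlt.
by move=> /orP[/eqP ->|/IH]; [|exact].
Qed.

End LinearExpressions.

Ltac is_sort_type T :=
  lazymatch T with Type => idtac | Set => idtac | Prop => idtac end.

(* Convertible atoms need not be identical: the same operation may be inferred
   through different paths of the algebraic hierarchy. *)
Ltac lin_same x y :=
  first
    [ constr_eq x y
    | lazymatch x with
      | @GRing.mul _ ?a ?b =>
        lazymatch y with @GRing.mul _ ?c ?d => lin_same a c; lin_same b d end
      | @GRing.Linear.sort _ _ _ _ ?f ?a =>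
        lazymatch y with
        | @GRing.Linear.sort _ _ _ _ ?g ?b => lin_same f g; lin_same a b
        end
      | @GRing.one _ => lazymatch y with @GRing.one _ => idtac end
      | ?f ?a => lazymatch y with ?g ?b => lin_same f g; lin_same a b end
      end
    | let T := type of x in is_sort_type T; unify x y ].

Ltac lin_index x env :=
  lazymatch env with
  | nil => fail
  | ?y :: ?env' =>
    match constr:(tt) with
    | _ => let _ := match constr:(tt) with _ => lin_same x y end in constr:(0%N)
    | _ => let i := lin_index x env' in constr:(S i)
    end
  end.

Ltac lin_add x env :=
  match constr:(tt) with
  | _ => let i := lin_index x env in env
  | _ => constr:(x :: env)
  end.

Ltac lin_atoms env x :=
  lazymatch x with
  | @Algebra.add _ ?a ?b => let env := lin_atoms env a in lin_atoms env b
  | @Algebra.opp _ ?a => lin_atoms env a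
  | @Algebra.zero _ => env
  | @GRing.scale _ _ _ ?a => lin_atoms env a
  | _ => lin_add x env
  end.

Ltac lin_reify K env x :=
  lazymatch x with
  | @Algebra.add _ ?a ?b =>
    let ea := lin_reify K env a in let eb := lin_reify K env b in
    constr:(@LAdd K ea eb)
  | @Algebra.opp _ ?a => let ea := lin_reify K env a in constr:(@LOpp K ea)
  | @Algebra.zero _ => constr:(@LZero K)
  | @GRing.scale _ _ ?k ?a =>
    let ea := lin_reify K env a in constr:(@LScale K k ea)
  | _ => let i := lin_index x env in constr:(@LVar K i)
  end.

Ltac lin_setup K :=
  lazymatch goal with
  | |- @eq ?T ?x ?y =>
    let env := lin_atoms (@nil T) x in let env := lin_atoms env y in
    let e1 := lin_reify K env x in let e2 := lin_reify K env y in
    refine (@lin_eval_eq K _ env e1 e2 _);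
    cbn [lin_coefs_eq lin_coef size Nat.eqb]
  end.

(** Products of operators do not commute, so the rewriting rules of a ring only
    bring an identity to the form of an equality of linear combinations of
    monomials; the coefficients on both sides are then compared as complex
    numbers. *)
Tactic Notation "linear_ring" constr(R) :=
  lin_setup (complex R : pzRingType); do ?split=> //; by [ring | field].

Tactic Notation "linear_ring" constr(R) "using" constr(H) :=
  lin_setup (complex R : pzRingType); do ?split=> //; by [ring: H | field: H].

(** The norm of a complex space is a complex number; real inequalities are
    easier to combine. *)
Definition nrm {R : realType} {V : normedModType R[i]} (x : V) : R :=
  complex.Re `|x|.

Section RealNorm.
Context {R : realType} {V : normedModType R[i]}.
Implicit Types (x y : V) (k : R[i]) (c : R).

Lemma nrmE x : (nrm x)%:C%C = `|x|.
Proof. by rewrite /nrm RRe_real// normr_real. Qed.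

Lemma nrm_ge0 x : 0 <= nrm x.
Proof. by have := normr_ge0 x; rewrite -nrmE lecR. Qed.

Lemma nrmD x y : nrm (x + y) <= nrm x + nrm y.
Proof. by have := ler_normD x y; rewrite -!nrmE -rmorphD lecR. Qed.

Lemma nrmN x : nrm (- x) = nrm x.
Proof. by rewrite /nrm normrN. Qed.

Lemma nrmB x y : nrm (x - y) <= nrm x + nrm y.
Proof. by rewrite -(nrmN y) nrmD. Qed.

Lemma nrm_distC x y : nrm (x - y) = nrm (y - x).
Proof. by rewrite -nrmN opprB. Qed.

Lemma nrmZ k x : nrm (k *: x) = complex.Re `|k| * nrm x.
Proof.
have := normrZ k x; rewrite -!nrmE -{2}(RRe_real (normr_real k)) -rmorphM.
by move=> /complexI ->.
Qed.

Lemma nrm0 : nrm (0 : V) = 0.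
Proof. by rewrite /nrm normr0. Qed.

Lemma nrm_eq0 x : nrm x = 0 -> x = 0.
Proof. by move=> x0; apply/eqP; rewrite -normr_eq0 -nrmE x0. Qed.

Lemma nrm_le_eq0 x : (forall e, 0 < e -> nrm x <= e) -> x = 0.
Proof.
move=> h; apply: nrm_eq0; apply/eqP; rewrite eq_le nrm_ge0 andbT.
by apply/ler_addgt0Pl => e e0; rewrite addr0; exact: h.
Qed.

End RealNorm.

Section RealNormScalars.
Context {R : realType}.

Lemma Re_norm_real (c : R) : complex.Re `|c%:C%C : R[i]| = `|c|.
Proof. by rewrite normc_def /= expr0n/= addr0 sqrtr_sqr. Qed.

Lemma Re_norm_ge0 (k : R[i]) : 0 <= complex.Re `|k|.
Proof. by have := normr_ge0 k; rewrite -{1}(RRe_real (normr_real k)) lecR. Qed.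

End RealNormScalars.

Section Completeness.
Context {R : realType} {V : completeNormedModType R[i]}.

Lemma nrm_cauchy_lim (u : nat -> V) (d : nat -> R) :
  (forall n m, (n <= m)%N -> nrm (u m - u n) <= d n) ->
  (forall e, 0 < e -> exists n, d n < e) ->
  exists l, forall n, nrm (u n - l) <= d n.
Proof.
move=> ud d0.
have cu : cvg (u @ \oo).
  apply: cauchy_cvg; apply/cauchy_ballP => e; rewrite ltcE => /andP[/eqP ei er].
  rewrite /= in ei er.
  have [N dN] := d0 _ (divr_gt0 er (ltr0n _ 2)).
  pose U := [set u n | n in [set n | (N <= n)%N]].
  have FU : nbhs (u @ \oo) U by exists N => // n Nn; exists n.
  exists (U, U); first by split.
  case=> _ _ [/= [n /= Nn <-] [m /= Nm <-]]; rewrite -ball_normE /=.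
  suff : nrm (u n - u m) < complex.Re e.
    by rewrite -nrmE ltcE /= ei eqxx.
  have -> : u n - u m = (u n - u N) - (u m - u N) by rewrite opprB addrA subrK.
  have := ud _ _ Nn; have := ud _ _ Nm; have := nrmB (u n - u N) (u m - u N).
  lra.
exists (lim (u @ \oo)) => n.
apply/ler_addgt0Pr => e e0.
have ec : (0 : R[i]) < e%:C%C by rewrite ltcR.
have /cvgrPdist_lt /(_ _ ec) [M _ hM] := cu.
have := hM (maxn M n) (leq_maxl _ _); rewrite -nrmE ltcR => h1.
have h2 := ud _ _ (leq_maxr M n).
have -> : u n - lim (u @ \oo) =
    (u n - u (maxn M n)) + (u (maxn M n) - lim (u @ \oo)).
  by rewrite addrA subrK.
have := nrmD (u n - u (maxn M n)) (u (maxn M n) - lim (u @ \oo)).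
rewrite (nrm_distC (u n)) (nrm_distC _ (lim (u @ \oo))); lra.
Qed.

End Completeness.

(** * Multipliers of a C*-algebra *)

Section CStarNorm.
Context {R : realType} {A : cstarAlgType R}.
Implicit Types (a b : A).

Lemma cmul0r a : cmul a 0 = 0.
Proof. by apply: (addrI (cmul a 0)); rewrite -cmulDr !addr0. Qed.

Lemma cmulNr a b : cmul a (- b) = - cmul a b.
Proof. by apply: (addrI (cmul a b)); rewrite -cmulDr !subrr cmul0r. Qed.

Lemma cmul0l a : cmul 0 a = 0.
Proof. by apply: (addrI (cmul 0 a)); rewrite -cmulDl !addr0. Qed.

Lemma cmulNl a b : cmul (- a) b = - cmul a b.
Proof. by apply: (addrI (cmul a b)); rewrite -cmulDl !subrr cmul0l. Qed.

Lemma cmulBr a b c : cmul a (b - c) = cmul a b - cmul a c.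
Proof. by rewrite cmulDr cmulNr. Qed.

Lemma cstar0 : cstar (0 : A) = 0.
Proof. by apply: (addrI (cstar (0 : A))); rewrite -cstarD !addr0. Qed.

Lemma cstarN a : cstar (- a) = - cstar a.
Proof. by apply: (addrI (cstar a)); rewrite -cstarD !subrr cstar0. Qed.

Lemma cstarB a b : cstar (a - b) = cstar a - cstar b.
Proof. by rewrite cstarD cstarN. Qed.

Lemma nrm_cmul a b : nrm (cmul a b) <= nrm a * nrm b.
Proof. by have := cnormM a b; rewrite -!nrmE -rmorphM lecR. Qed.

Lemma nrm_cstar_sq a : nrm (cmul (cstar a) a) = nrm a ^+ 2.
Proof. by apply: complexI; have := cstar_norm a; rewrite -!nrmE rmorphXn. Qed.

Lemma nrm_cstar a : nrm (cstar a) = nrm a.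
Proof.
suff le b : nrm b <= nrm (cstar b).
  by apply/le_anti/andP; split=> //; rewrite -{2}(cstarK a).
have [->|b0] := eqVneq b 0; first by rewrite cstar0.
have b1 : 0 < nrm b.
  rewrite lt_neqAle nrm_ge0 andbT eq_sym.
  by apply: contra_neq b0; exact: nrm_eq0.
rewrite -(ler_pM2r b1) -expr2 -nrm_cstar_sq; exact: nrm_cmul.
Qed.

Lemma cmul_star_eq0 a : cmul (cstar a) a = 0 -> a = 0.
Proof.
move=> h; apply: nrm_eq0; apply/eqP; rewrite -sqrf_eq0 -nrm_cstar_sq h.
by rewrite nrm0.
Qed.

(** The products with all c^* separate points; this makes adjoints unique and
    maps with an adjoint additive. *)
Lemma cmul_star_inj a b :
  (forall c : A, cmul (cstar c) a = cmul (cstar c) b) -> a = b.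
Proof.
by move=> h; apply/eqP; rewrite -subr_eq0; apply/eqP/cmul_star_eq0;
   rewrite cmulBr h subrr.
Qed.

End CStarNorm.

(** A C*-algebra need not have a unit. Its multipliers, the bounded adjointable
    maps of A as a right module over itself, are a unital *-algebra in which A
    sits as left multiplications; a positive element of A is then studied
    through expressions such as 1 - a. *)
Record multiplier {R : realType} (A : cstarAlgType R) := Multiplier {
  mfun :> A -> A;
  madj : A -> A;
  mult_adj : forall a b, cmul (cstar (mfun a)) b = cmul (cstar a) (madj b);
  mult_bounded : exists c : R, forall a, nrm (mfun a) <= c * nrm a
}.
Arguments Multiplier {R A mfun madj} _ _.

HB.instance Definition _ {R : realType} (A : cstarAlgType R) :=
  gen_eqMixin (multiplier A).
HB.instance Definition _ {R : realType} (A : cstarAlgType R) :=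
  gen_choiceMixin (multiplier A).

Section Multipliers.
Context {R : realType} {A : cstarAlgType R}.
Local Notation M := (multiplier A).
Implicit Types (S T : M) (a b : A).

Lemma mult_ext S T : (forall a, S a = T a) -> S = T.
Proof.
case: S T => [f f' fa fb] [g g' ga gb] /= fg.
have {fg} fg : f = g by apply/funext.
rewrite fg in fa fb *.
have f'g' : f' = g'.
  by apply/funext => b; apply: cmul_star_inj => c; rewrite -fa ga.
by rewrite f'g' in fa *; congr Multiplier; exact: Prop_irrelevance.
Qed.

Lemma madj_adj T a b : cmul (cstar (madj T a)) b = cmul (cstar a) (T b).
Proof. by apply: (can_inj cstarK); rewrite !cstarM !cstarK -mult_adj. Qed.

Definition mbd T (c : R) := forall a, nrm (T a) <= c * nrm a.

Lemma mbd_madj T c : mbd T c -> forall a, nrm (madj T a) <= c * nrm a.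
Proof.
move=> Tc a; have [->|b0] := eqVneq (nrm (madj T a)) 0.
  have := Tc (cstar a); rewrite nrm_cstar; have := nrm_ge0 (T (cstar a)); lra.
have b1 : 0 < nrm (madj T a) by rewrite lt_neqAle nrm_ge0 andbT eq_sym.
rewrite -(ler_pM2r b1) -expr2 -nrm_cstar_sq madj_adj.
apply: (le_trans (nrm_cmul _ _)); rewrite nrm_cstar mulrAC mulrC.
by apply: ler_wpM2r; [exact: nrm_ge0|exact: Tc].
Qed.

Lemma multD_adj S T a b :
  cmul (cstar (S a + T a)) b = cmul (cstar a) (madj S b + madj T b).
Proof. by rewrite cstarD cmulDl !mult_adj cmulDr. Qed.

Lemma multD_bounded S T :
  exists c : R, forall a, nrm (S a + T a) <= c * nrm a.
Proof.
have [[c Sc] [d Td]] := (mult_bounded S, mult_bounded T).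
exists (c + d) => a; rewrite mulrDl.
by apply: (le_trans (nrmD _ _)); rewrite lerD.
Qed.

Definition multD S T : M := Multiplier (multD_adj S T) (multD_bounded S T).

Lemma multM_adj S T a b :
  cmul (cstar (S (T a))) b = cmul (cstar a) (madj T (madj S b)).
Proof. by rewrite !mult_adj. Qed.

Lemma multM_bounded S T : exists c : R, forall a, nrm (S (T a)) <= c * nrm a.
Proof.
have [[c Sc] [d Td]] := (mult_bounded S, mult_bounded T).
exists (`|c| * `|d|) => a.
apply: (le_trans (Sc _)).
apply: (@le_trans _ _ (`|c| * nrm (T a))).
  by rewrite ler_wpM2r ?nrm_ge0 ?ler_norm.
rewrite -mulrA ler_wpM2l//.
by apply: (le_trans (Td _)); rewrite ler_wpM2r ?nrm_ge0 ?ler_norm.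
Qed.

Definition multM S T : M := Multiplier (multM_adj S T) (multM_bounded S T).

Lemma multZ_adj (k : R[i]) T a b :
  cmul (cstar (k *: T a)) b = cmul (cstar a) (conjc k *: madj T b).
Proof. by rewrite cstarZ -cscaleAl mult_adj cscaleAr. Qed.

Lemma multZ_bounded (k : R[i]) T :
  exists c : R, forall a, nrm (k *: T a) <= c * nrm a.
Proof.
have [c Tc] := mult_bounded T; exists (complex.Re `|k| * c) => a.
by rewrite nrmZ -mulrA ler_wpM2l ?Re_norm_ge0.
Qed.

Definition multZ (k : R[i]) T : M :=
  Multiplier (multZ_adj k T) (multZ_bounded k T).

Lemma mult1_bounded : exists c : R, forall a, nrm a <= c * nrm a.
Proof. by exists 1 => a; rewrite mul1r. Qed.

Definition mult1 : M := @Multiplier _ _ id id (fun _ _ => erefl) mult1_bounded.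

Lemma mult0_adj a b : cmul (cstar (0 : A)) b = cmul (cstar a) 0.
Proof. by rewrite cstar0 cmul0l cmul0r. Qed.

Lemma mult0_bounded : exists c : R, forall a, nrm (0 : A) <= c * nrm a.
Proof. by exists 0 => a; rewrite mul0r nrm0. Qed.

Definition mult0 : M := Multiplier mult0_adj mult0_bounded.

Lemma star_bounded T : exists c : R, forall a, nrm (madj T a) <= c * nrm a.
Proof. by have [c /mbd_madj] := mult_bounded T; exists c. Qed.

Definition star T : M := Multiplier (madj_adj T) (star_bounded T).

Let multDA : associative multD.
Proof. by move=> S T U; apply: mult_ext => a /=; rewrite addrA. Qed.
Let multDC : commutative multD.
Proof. by move=> S T; apply: mult_ext => a /=; rewrite addrC. Qed.
Let mult0D : left_id mult0 multD.
Proof. by move=> T; apply: mult_ext => a /=; rewrite add0r. Qed.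
Let multND : left_inverse mult0 (multZ (-1)) multD.
Proof. by move=> T; apply: mult_ext => a /=; rewrite scaleN1r addNr. Qed.

HB.instance Definition _ :=
  GRing.isZmodule.Build M multDA multDC mult0D multND.

Lemma mfunD T a b : T (a + b) = T a + T b.
Proof.
by apply: cmul_star_inj => c; rewrite cmulDr -!madj_adj cmulDr.
Qed.

Lemma mfunZ T (k : R[i]) a : T (k *: a) = k *: T a.
Proof.
by apply: cmul_star_inj => c; rewrite -cscaleAr -!madj_adj cscaleAr.
Qed.

Let multMA : associative multM.
Proof. by move=> S T U; apply: mult_ext. Qed.
Let mult1M : left_id mult1 multM.
Proof. by move=> S; apply: mult_ext. Qed.
Let multM1 : right_id mult1 multM.
Proof. by move=> S; apply: mult_ext. Qed.
Let multMDl : left_distributive multM +%R.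
Proof. by move=> S T U; apply: mult_ext. Qed.
Let multMDr : right_distributive multM +%R.
Proof. by move=> S T U; apply: mult_ext => a /=; rewrite mfunD. Qed.

HB.instance Definition _ :=
  GRing.Zmodule_isPzRing.Build M multMA mult1M multM1 multMDl multMDr.

Let multZA (j k : R[i]) T : multZ j (multZ k T) = multZ (j * k) T.
Proof. by apply: mult_ext => a /=; rewrite scalerA. Qed.
Let multZ1 : left_id 1 multZ.
Proof. by move=> T; apply: mult_ext => a /=; rewrite scale1r. Qed.
Let multZDr : right_distributive multZ +%R.
Proof. by move=> k S T; apply: mult_ext => a /=; rewrite scalerDr. Qed.
Let multZDl T : {morph multZ^~ T : j k / j + k}.
Proof. by move=> j k; apply: mult_ext => a /=; rewrite scalerDl. Qed.

HB.instance Definition _ :=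
  GRing.Zmodule_isLmodule.Build R[i] M multZA multZ1 multZDr multZDl.

Lemma multZAl (k : R[i]) S T : (k *: S) * T = k *: (S * T).
Proof. exact: mult_ext. Qed.

Lemma multZAr (k : R[i]) S T : S * (k *: T) = k *: (S * T).
Proof. by apply: mult_ext => a /=; rewrite mfunZ. Qed.

Lemma starK : involutive star.
Proof. by move=> T; apply: mult_ext. Qed.

Lemma starD S T : star (S + T) = star S + star T.
Proof. exact: mult_ext. Qed.

Lemma starZ k T : star (k *: T) = conjc k *: star T.
Proof. exact: mult_ext. Qed.

Lemma star0 : star 0 = 0.
Proof. by apply: (addrI (star 0)); rewrite -starD !addr0. Qed.

Lemma starN T : star (- T) = - star T.
Proof. by apply: (addrI (star T)); rewrite -starD !subrr star0. Qed.

Lemma starB S T : star (S - T) = star S - star T.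
Proof. by rewrite starD starN. Qed.

Lemma starM S T : star (S * T) = star T * star S.
Proof. exact: mult_ext. Qed.

Lemma star1 : star 1 = 1.
Proof. exact: mult_ext. Qed.

Lemma star_sq_eq0 T : star T * T = 0 -> T = 0.
Proof.
move=> TT; apply: mult_ext => a; apply: cmul_star_eq0.
by rewrite mult_adj -[madj T _]/((star T * T) a) TT cmul0r.
Qed.

Lemma mbdD S T c d : mbd S c -> mbd T d -> mbd (S + T) (c + d).
Proof.
by move=> Sc Td a; rewrite mulrDl; apply: (le_trans (nrmD _ _)); rewrite lerD.
Qed.

Lemma mbdM S T c d : 0 <= c -> mbd S c -> mbd T d -> mbd (S * T) (c * d).
Proof.
move=> c0 Sc Td a; rewrite -mulrA.
by apply: (le_trans (Sc _)); rewrite ler_wpM2l.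
Qed.

Lemma mbdZ (k : R[i]) T c : mbd T c -> mbd (k *: T) (complex.Re `|k| * c).
Proof.
by move=> Tc a; rewrite /= nrmZ -mulrA ler_wpM2l ?Re_norm_ge0 ?Tc.
Qed.

Lemma mbdR (k : R) T c : 0 <= k -> mbd T c -> mbd (k%:C%C *: T) (k * c).
Proof. by move=> k0 /(mbdZ k%:C%C); rewrite Re_norm_real ger0_norm. Qed.

Lemma mbdN T c : mbd T c -> mbd (- T) c.
Proof. by move=> /(mbdZ (-1)); rewrite normrN1 mul1r. Qed.

Lemma mbdB S T c d : mbd S c -> mbd T d -> mbd (S - T) (c + d).
Proof. by move=> Sc /mbdN; exact: mbdD. Qed.

Lemma mbd_star T c : mbd T c -> mbd (star T) c.
Proof. exact: mbd_madj. Qed.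

Lemma mbd1 : mbd 1 1.
Proof. by move=> a; rewrite mul1r. Qed.

Lemma mbd0 c : 0 <= c -> mbd 0 c.
Proof. by move=> c0 a; rewrite /= nrm0 mulr_ge0 ?nrm_ge0. Qed.

Lemma mbdW T c d : c <= d -> mbd T c -> mbd T d.
Proof.
by move=> cd Tc a; apply: (le_trans (Tc _)); rewrite ler_wpM2r ?nrm_ge0.
Qed.

Lemma mbd_exists T : exists2 c : R, 0 < c & mbd T c.
Proof.
have [c Tc] := mult_bounded T; exists (`|c| + 1); first by rewrite ltr_wpDl.
by apply: (mbdW _ Tc); rewrite ler_wpDr// ler_norm.
Qed.

Lemma mbd_eq0 T : (forall e, 0 < e -> mbd T e) -> T = 0.
Proof.
move=> Te; apply: mult_ext => a; apply: nrm_le_eq0 => e e0.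
have a0 := nrm_ge0 a; have a1 : 0 < nrm a + 1 by lra.
apply: (le_trans (Te (e / (nrm a + 1)) _ a)); first by rewrite divr_gt0.
rewrite mulrAC ler_pdivrMr// ler_pM2l//; lra.
Qed.

(** A multiplier with star T * T = c preserves norms up to the factor sqrt c;
    this is where the C*-identity of A enters. *)
Lemma mbd_sqrt T (c : R) : 0 <= c ->
  star T * T = c%:C%C *: (1 : M) -> mbd T (Num.sqrt c).
Proof.
move=> c0 TT a; rewrite -ler_sqr ?nnegrE ?mulr_ge0 ?nrm_ge0 ?sqrtr_ge0//.
rewrite exprMn sqr_sqrtr// -!nrm_cstar_sq mult_adj.
rewrite -[madj T _]/((star T * T) a) TT /= -cscaleAr nrmZ.
by rewrite Re_norm_real ger0_norm.
Qed.

(** The pointwise limit of a Cauchy sequence of multipliers has an adjoint,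
    the limit of the adjoints, because T and star T have the same norm. *)
Lemma mult_cauchy_lim (T : nat -> M) (d : nat -> R) :
  (forall n, 0 <= d n) ->
  (forall n m, (n <= m)%N -> mbd (T m - T n) (d n)) ->
  (forall e, 0 < e -> exists n, d n < e) ->
  exists L, forall n, mbd (T n - L) (d n).
Proof.
move=> dn0 Td d0.
have lim (u : nat -> A -> A) :
    (forall n m a, (n <= m)%N -> nrm (u m a - u n a) <= d n * nrm a) ->
    exists l : A -> A, forall n a, nrm (u n a - l a) <= d n * nrm a.
  move=> ud; suff /choice[l lP] : forall a, exists b, forall n,
      nrm (u n a - b) <= d n * nrm a by exists l => n a; exact: lP.
  move=> a; apply: (@nrm_cauchy_lim _ _ (fun n => u n a)) => [n m|e e0].
    exact: ud.
  have a0 := nrm_ge0 a; have a1 : 0 < nrm a + 1 by lra.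
  have [|n dn] := d0 (e / (nrm a + 1)); first by rewrite divr_gt0.
  exists n; rewrite ltr_pdivlMr// mulrDr mulr1 in dn; have := dn0 n; lra.
have [|f fP] := lim T.
  by move=> n m a nm; have := Td _ _ nm a; rewrite /= scaleN1r.
have [|g gP] := lim (fun n => madj (T n)).
  move=> n m a nm; have := mbd_star (Td _ _ nm).
  by rewrite starB => /(_ a); rewrite /= scaleN1r.
have fg a b : cmul (cstar (f a)) b = cmul (cstar a) (g b).
  apply/eqP; rewrite -subr_eq0; apply/eqP/nrm_le_eq0 => e e0.
  set c := nrm a * nrm b; have c0 : 0 <= c by rewrite mulr_ge0 ?nrm_ge0.
  have c1 : 0 < 2 * c + 1 by lra.
  have [|n dn] := d0 (e / (2 * c + 1)); first by rewrite divr_gt0.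
  have -> : cmul (cstar (f a)) b - cmul (cstar a) (g b) =
      cmul (cstar a) (madj (T n) b - g b) - cmul (cstar (T n a - f a)) b.
    rewrite cmulBr -mult_adj cstarB cmulDl cmulNl.
    linear_ring R.
  have h1 := gP n b; have h2 := fP n a.
  apply: (le_trans (nrmB _ _)).
  have := nrm_cmul (cstar a) (madj (T n) b - g b).
  have := nrm_cmul (cstar (T n a - f a)) b.
  rewrite !nrm_cstar => h3 h4.
  have h5 := ler_wpM2l (nrm_ge0 a) h1; have h6 := ler_wpM2r (nrm_ge0 b) h2.
  rewrite ltr_pdivlMr// in dn; rewrite /c in dn c0 c1; have := dn0 n; nra.
have fb : exists c : R, forall a, nrm (f a) <= c * nrm a.
  have [c Tc] := mult_bounded (T 0%N); exists (c + d 0%N) => a.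
  have -> : f a = T 0%N a - (T 0%N a - f a) by rewrite opprB addrC subrK.
  by rewrite mulrDl; apply: (le_trans (nrmB _ _)); rewrite lerD.
exists (Multiplier fg fb) => n a /=; rewrite scaleN1r; exact: fP.
Qed.

End Multipliers.

(** * Square roots *)

Section SquareRoots.
Context {R : realType} {A : cstarAlgType R}.
Local Notation M := (multiplier A).
Local Notation "c *r T" := (c%:C%C *: (T : M)) (at level 40).
Implicit Types (S T X Y : M) (c r : R).

Definition bicommute X Y := forall T, T * X = X * T -> T * Y = Y * T.

Lemma starR c T : star (c *r T) = c *r star T.
Proof. by rewrite starZ conjc_real. Qed.

Lemma real_scaleA c r T : c *r (r *r T) = (c * r) *r T.
Proof. by rewrite scalerA -rmorphM. Qed.

(** If 1 - y is a square root of 1 - x, then y = (x + y ^ 2) / 2. *)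
Fixpoint root_iter X (n : nat) : M :=
  if n is n'.+1 then 2^-1 *r (X + root_iter X n' * root_iter X n') else 0.

(** This is 1 minus the same iteration for the number x = 1, which dominates
    the one for any X of norm at most 1. *)
Fixpoint root_gap (n : nat) : R :=
  if n is n'.+1 then root_gap n' - root_gap n' ^+ 2 / 2 else 1.

Lemma root_gap_bounds n : 0 <= root_gap n <= 1.
Proof. by elim: n => [|n /andP[h1 h2]] /=; apply/andP; split; nra. Qed.

(** Slow but sufficient: d - d ^ 2 / 2 decreases to 0 like 2 / n. *)
Lemma root_gap_le n : root_gap n <= 2 / n.+2%:R.
Proof.
elim: n => [|n IH] /=; first by rewrite divff.
have /andP[h1 h2] := root_gap_bounds n.
have n0 : 0 <= n%:R :> R by [].
have e2 : n.+2%:R = n%:R + 2 :> R by rewrite -addn2 natrD.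
have e3 : n.+3%:R = n%:R + 3 :> R by rewrite -addn3 natrD.
rewrite ler_pdivlMr ?ltr0n// in IH; rewrite ler_pdivlMr ?ltr0n//.
move: IH; rewrite e2 e3.
move: (root_gap n) (n%:R : R) h1 h2 n0 => d x d0 d1 x0 h.
have h3 : d * (x + 2) * (d * (x + 2)) <= 2 * (d * (x + 2)).
  by rewrite ler_wpM2r// mulr_ge0//; lra.
nra.
Qed.

Lemma root_gap_cvg0 e : 0 < e -> exists n, root_gap n < e.
Proof.
move=> e0; have := archi_boundP (ltW (divr_gt0 (ltr0n R 2) e0)).
set n := Num.bound _ => h; exists n; apply: (le_lt_trans (root_gap_le _)).
rewrite ltr_pdivrMr// mulrC -ltr_pdivrMr//; apply: (lt_trans h).
by rewrite ltr_nat -addn2 -{1}(addn0 n) ltn_add2l.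
Qed.

Lemma root_iter_comm X T n : T * X = X * T ->
  T * root_iter X n = root_iter X n * T.
Proof.
move=> TX; elim: n => [|n IH] /=; first by rewrite mulr0 mul0r.
rewrite multZAr multZAl mulrDr mulrDl TX mulrA IH -mulrA IH mulrA.
by [].
Qed.

Lemma root_iter_comm2 X n m :
  root_iter X n * root_iter X m = root_iter X m * root_iter X n.
Proof. by apply: root_iter_comm; rewrite -root_iter_comm. Qed.

Lemma root_iter_star X n : star X = X -> star (root_iter X n) = root_iter X n.
Proof.
by move=> sX; elim: n => [|n IH] /=; rewrite ?star0// starR starD starM IH sX.
Qed.

Lemma root_iter_bd X n : mbd X 1 -> mbd (root_iter X n) (1 - root_gap n).
Proof.
move=> X1; elim: n => [|n IH] /=; first by apply: mbd0; rewrite subrr.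
have /andP[h1 h2] := root_gap_bounds n.
have h : mbd (root_iter X n * root_iter X n)
    ((1 - root_gap n) * (1 - root_gap n)).
  by apply: mbdM; rewrite ?subr_ge0.
have half0 : 0 <= 2^-1 :> R by lra.
apply: (mbdW _ (mbdR half0 (mbdD X1 h))); lra.
Qed.

(** The difference of two consecutive squares factors because the iterates
    commute; this is what the same iteration for numbers dominates. *)
Lemma root_iter_step X n : mbd X 1 ->
  mbd (root_iter X n.+1 - root_iter X n) (root_gap n - root_gap n.+1).
Proof.
move=> X1; have half0 : 0 <= 2^-1 :> R by lra.
elim: n => [|n IH].
  by rewrite /= mulr0 addr0 subr0; apply: (mbdW _ (mbdR half0 X1)); lra.
have -> : root_iter X n.+2 - root_iter X n.+1 = 2^-1 *r
    ((root_iter X n.+1 - root_iter X n) * (root_iter X n.+1 + root_iter X n)).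
  rewrite mulrDr !mulrDl !mulNr (root_iter_comm2 X n).
  have -> : root_iter X n.+2 =
    2^-1 *r (X + root_iter X n.+1 * root_iter X n.+1) by [].
  have E : root_iter X n.+1 =
    2^-1 *r (X + root_iter X n * root_iter X n) by [].
  rewrite {3}E; set Z := root_iter X n.+1. linear_ring R.
have h1 := root_gap_bounds n; have h2 := root_gap_bounds n.+1.
have h3 : 0 <= root_gap n - root_gap n.+1 by rewrite /=; nra.
have h := mbdM h3 IH (mbdD (root_iter_bd n.+1 X1) (root_iter_bd n X1)).
apply: (mbdW _ (mbdR half0 h)).
by rewrite [root_gap n.+2]/= -/(root_gap n.+1) [root_gap n.+1]/=; lra.
Qed.

Lemma root_iter_cauchy X n m : mbd X 1 -> (n <= m)%N ->
  mbd (root_iter X m - root_iter X n) (root_gap n).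
Proof.
move=> X1 /subnKC <-; elim: (m - n)%N => {m} [|k IH].
  by rewrite addn0 subrr; apply: mbd0; have /andP[] := root_gap_bounds n.
suff: mbd (root_iter X (n + k.+1) - root_iter X n)
    (root_gap n - root_gap (n + k.+1)).
  by apply: mbdW; have /andP[] := root_gap_bounds (n + k.+1); lra.
elim: k.+1 => {k IH} [|k IH].
  by rewrite addn0 !subrr; exact: mbd0.
rewrite addnS; have := mbdD (root_iter_step (n + k) X1) IH.
by rewrite addrA subrK => /(mbdW _); apply; lra.
Qed.

Lemma mbd_gap_eq0 T c : 0 <= c -> (forall n, mbd T (c * root_gap n)) -> T = 0.
Proof.
move=> c0 h; apply: mbd_eq0 => e e0.
have c1 : 0 < c + 1 by lra.
have [n hn] := root_gap_cvg0 (divr_gt0 e0 c1).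
apply: (mbdW _ (h n)); rewrite ltr_pdivlMr// in hn.
by have /andP[] := root_gap_bounds n; lra.
Qed.

(** Square roots of 1 - X without functional calculus: the iteration converges
    even when X has norm exactly 1, because it is dominated by the iteration
    for the number 1. *)
Lemma one_sub_root X : star X = X -> mbd X 1 -> exists Y,
  [/\ star Y = Y, mbd Y 1, (1 - Y) * (1 - Y) = 1 - X & bicommute X Y].
Proof.
move=> sX X1; have [|n m||Y YP] := @mult_cauchy_lim _ _ (root_iter X) root_gap.
- by move=> n; have /andP[] := root_gap_bounds n.
- exact: root_iter_cauchy.
- exact: root_gap_cvg0.
have g0 n : 0 <= root_gap n by have /andP[] := root_gap_bounds n.
have Y1 : mbd Y 1.
  by have := mbdN (YP 0%N); rewrite /= sub0r opprK.
exists Y; split => //.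
- apply/eqP; rewrite -subr_eq0; apply/eqP; apply: (@mbd_gap_eq0 _ 2) => // n.
  have -> : star Y - Y = (root_iter X n - Y) - star (root_iter X n - Y).
    by rewrite starB root_iter_star//; linear_ring R.
  by have := mbdB (YP n) (mbd_star (YP n)); apply: mbdW; lra.
- apply/eqP; rewrite -subr_eq0; apply/eqP; apply: (@mbd_gap_eq0 _ 4) => // n.
  set Z := root_iter X n.
  have -> : (1 - Y) * (1 - Y) - (1 - X) =
      2 *r (root_iter X n.+1 - Y) - ((Z - Y) * Y + Z * (Z - Y)).
    rewrite /= -/Z !mulrDr !mulrDl !mulrN !mulNr !mul1r !mulr1; linear_ring R.
  have h1 : mbd (Z - Y) (root_gap n) := YP n.
  have h2 : mbd Z 1.
    by apply: (mbdW _ (root_iter_bd n X1)); have := g0 n; lra.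
  have h := mbdB (mbdR (ler0n R 2) (YP n.+1))
    (mbdD (mbdM (g0 n) h1 Y1) (mbdM ler01 h2 h1)).
  by apply: (mbdW _ h) => /=; have := g0 n; nra.
- move=> T TX; apply/eqP; rewrite -subr_eq0; apply/eqP.
  have [c c0 Tc] := mbd_exists T.
  apply: (@mbd_gap_eq0 _ (2 * c)) => [|n]; first by lra.
  have -> : T * Y - Y * T = (root_iter X n - Y) * T - T * (root_iter X n - Y).
    rewrite mulrDr mulrDl mulrN mulNr (root_iter_comm n TX); linear_ring R.
  have := mbdB (mbdM (g0 n) (YP n) Tc) (mbdM (ltW c0) Tc (YP n)).
  by apply: mbdW; lra.
Qed.

End SquareRoots.

(** * Positive multipliers *)

Section Positivity.
Context {R : realType} {A : cstarAlgType R}.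
Local Notation M := (multiplier A).
Local Notation "c *r T" := (c%:C%C *: (T : M)) (at level 40).
Implicit Types (S T X Y h v p q : M) (c r : R).

Lemma conjc_i : conjc ('i%C : R[i]) = - 'i%C.
Proof. by apply/eqP; rewrite eq_complex /= oppr0 !eqxx. Qed.

Lemma mulc_ii : 'i%C * 'i%C = -1 :> R[i].
Proof. by rewrite -expr2 sqr_i. Qed.

Lemma comm_scale1 c T : (c *r 1) * T = T * (c *r 1).
Proof. by rewrite multZAl multZAr mul1r mulr1. Qed.

Lemma sqrt_mul_sqrt c : 0 <= c -> Num.sqrt c * Num.sqrt c = c.
Proof. by move=> c0; rewrite -expr2 sqr_sqrtr. Qed.

(** h is the real part of h + i v, which is sqrt n times a unitary. *)
Lemma circle_bd h v n : 0 <= n -> star h = h -> star v = v -> h * v = v * h ->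
  h * h + v * v = n *r 1 -> mbd h (Num.sqrt n).
Proof.
move=> n0 sh sv hv hvn; pose U := h + 'i%C *: v.
have sU : star U = h - 'i%C *: v.
  by rewrite starD starZ sh sv conjc_i scaleNr.
have U1 : star U * U = n *r 1.
  rewrite sU -hvn mulrDr !mulrDl !mulNr !multZAl !multZAr hv scalerA mulc_ii.
  by linear_ring R.
have U2 : star (star U) * star U = n *r 1.
  rewrite starK sU -hvn mulrDr !mulrDl !mulrN !multZAl !multZAr hv scalerA.
  rewrite mulc_ii.
  by linear_ring R.
have -> : h = 2^-1 *r (U + star U) by rewrite sU /U; linear_ring R.
have half0 : 0 <= 2^-1 :> R by lra.
by apply: (mbdW _ (mbdR half0 (mbdD (mbd_sqrt n0 U1) (mbd_sqrt n0 U2)))); lra.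
Qed.

(** Positivity is taken to mean being the square of a selfadjoint multiplier;
    that each star T * T is positive in this sense is the deep point. *)
Definition mpos T := exists h, star h = h /\ T = h * h.

Lemma mpos_star p : mpos p -> star p = p.
Proof. by case=> h [sh ->]; rewrite starM sh. Qed.

Lemma mposR c p : 0 <= c -> mpos p -> mpos (c *r p).
Proof.
move=> c0 [h [sh ->]]; exists (Num.sqrt c *r h); rewrite starR sh; split=> //.
by rewrite multZAl multZAr real_scaleA sqrt_mul_sqrt.
Qed.

Lemma mpos_one_sub Y : star Y = Y -> mbd Y 1 -> mpos (1 - Y).
Proof.
move=> sY /(one_sub_root sY)[Z [sZ _ <- _]]; exists (1 - Z).
by rewrite starB star1 sZ.
Qed.

Lemma mpos_sub r p : 0 < r -> star p = p -> mbd p r -> mpos (r *r 1 - p).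
Proof.
move=> r0 sp pr; have -> : r *r 1 - p = r *r (1 - r^-1 *r p).
  by rewrite scalerBr real_scaleA divff ?scale1r// gt_eqF.
apply: mposR; first exact: ltW.
apply: mpos_one_sub; first by rewrite starR sp.
have ri : 0 <= r^-1 by rewrite invr_ge0 ltW.
by apply: (mbdW _ (mbdR ri pr)); rewrite mulVf ?gt_eqF.
Qed.

Lemma mpos_root_of_bd r p : 0 < r -> star p = p -> mbd (r *r 1 - p) r ->
  exists g, [/\ star g = g, g * g = p, bicommute p g & mpos g].
Proof.
move=> r0 sp pr; have ri : 0 <= r^-1 by rewrite invr_ge0 ltW.
pose X := r^-1 *r (r *r 1 - p).
have XE : X = 1 - r^-1 *r p.
  by rewrite /X scalerBr real_scaleA mulVf ?scale1r// gt_eqF.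
have sX : star X = X by rewrite XE starB star1 starR sp.
have [|Y [sY Y1 YX bY]] := one_sub_root sX.
  by apply: (mbdW _ (mbdR ri pr)); rewrite mulVf ?gt_eqF.
exists (Num.sqrt r *r (1 - Y)); split.
- by rewrite starR starB star1 sY.
- rewrite multZAl multZAr real_scaleA sqrt_mul_sqrt ?ltW// YX XE.
  by rewrite opprB addrC subrK real_scaleA divff ?scale1r// gt_eqF.
- move=> T Tp; rewrite multZAl multZAr mulrBr mulrBl mulr1 mul1r bY//.
  by rewrite XE mulrBr mulrBl mulr1 mul1r multZAl multZAr Tp.
- by apply: mposR; [exact: sqrtr_ge0|exact: mpos_one_sub].
Qed.

(** h * h and its complement v * v to the constant c ^ 2 lie on a circle, so v
    is bounded by c. *)
Lemma square_sub_bd c h : 0 < c -> star h = h -> mbd h c ->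
  mbd ((c ^+ 2) *r 1 - h * h) (c ^+ 2).
Proof.
move=> c0 sh hc; have c2 : 0 < c ^+ 2 by rewrite exprn_gt0.
have [||v [sv vE bv _]] := @mpos_root_of_bd (c ^+ 2) ((c ^+ 2) *r 1 - h * h) c2.
- by rewrite starB starM sh starR star1.
- rewrite opprB addrC subrK expr2; apply: mbdM => //; exact: ltW.
have hv : h * v = v * h.
  by apply: bv; rewrite mulrBr mulrBl comm_scale1 mulrA.
have vc : mbd v c.
  have -> : c = Num.sqrt (c ^+ 2) by rewrite sqrtr_sqr gtr0_norm.
  apply: (circle_bd (v := h)) => //; first exact: ltW.
  by rewrite vE subrK.
by rewrite -vE expr2; apply: mbdM => //; exact: ltW.
Qed.

Lemma mpos_bd p : mpos p -> exists2 r, 0 < r & mbd (r *r 1 - p) r.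
Proof.
case=> h [sh ->]; have [c c0 hc] := mbd_exists h.
by exists (c ^+ 2); [rewrite exprn_gt0|exact: square_sub_bd].
Qed.

Lemma mpos_root p : mpos p ->
  exists g, [/\ star g = g, g * g = p, bicommute p g & mpos g].
Proof.
move=> pp; have [r r0 pr] := mpos_bd pp.
by apply: (mpos_root_of_bd r0) => //; exact: mpos_star.
Qed.

(** Having distance at most r from r passes to sums, and it characterizes the
    squares by the square root of 1 - X. *)
Lemma mposD p q : mpos p -> mpos q -> mpos (p + q).
Proof.
move=> pp pq; have [[r r0 pr] [s s0 qs]] := (mpos_bd pp, mpos_bd pq).
have [||g [sg <- _ _]] := @mpos_root_of_bd (r + s) (p + q) (addr_gt0 r0 s0).
- by rewrite starD !mpos_star.
- have -> : (r + s) *r 1 - (p + q) = (r *r 1 - p) + (s *r 1 - q).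
    by linear_ring R.
  exact: mbdD.
- by exists g.
Qed.

(** The square roots found above commute with everything that the positive
    multipliers commute with, in particular with each other. *)
Lemma mposM p q : mpos p -> mpos q -> p * q = q * p -> mpos (p * q).
Proof.
move=> /mpos_root[g [sg gp bg _]] /mpos_root[h [sh hq bh _]] pq.
have gh : g * h = h * g by apply: bh; apply/esym/bg; rewrite pq.
exists (g * h); split; first by rewrite starM sg sh gh.
by rewrite -gp -hq !mulrA -(mulrA g h g) -gh !mulrA.
Qed.

(** The norm is monotone on positive multipliers: c - p = q + (c - p - q) is
    a square v * v with v commuting with the root of p, and p lies with it on
    a circle. *)
Lemma mpos_le_bd c p q : 0 < c -> mpos p -> mpos q -> mbd (p + q) c -> mbd p c.
Proof.
move=> c0 pp pq pqc; have [h [sh hp bh _]] := mpos_root pp.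
have [|v [sv vE bv _]] := @mpos_root (c *r 1 - p).
  have -> : c *r 1 - p = q + (c *r 1 - (p + q)) by linear_ring R.
  by apply: mposD => //; apply: mpos_sub => //; rewrite starD !mpos_star.
have hv : h * v = v * h.
  by apply: bv; rewrite mulrBr mulrBl comm_scale1 -hp mulrA.
have hc : mbd h (Num.sqrt c).
  by apply: (circle_bd (v := v)) => //; [exact: ltW|rewrite vE hp addrC subrK].
have := mbdM (sqrtr_ge0 _) hc hc.
by rewrite hp sqrt_mul_sqrt// ltW.
Qed.

End Positivity.

(** * Positivity of T^* T *)

Section StarSquares.
Context {R : realType} {A : cstarAlgType R}.
Local Notation M := (multiplier A).
Local Notation "c *r T" := (c%:C%C *: (T : M)) (at level 40).
Implicit Types (S T p q : M) (r : R).

Lemma mbdX T r n : 0 <= r -> mbd T r -> mbd (T ^+ n) (r ^+ n).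
Proof.
move=> r0 Tr; elim: n => [|n IH]; first by rewrite !expr0; exact: mbd1.
by rewrite !exprS; exact: mbdM.
Qed.

(** With T = h + i k, T T^* + T^* T = 2 (h ^ 2 + k ^ 2). *)
Lemma mul_star_pos T p : star T * T = - p -> mpos p -> mpos (T * star T).
Proof.
move=> TT pp; pose h := 2^-1 *r (T + star T).
pose d := 2^-1 *r (star T - T); pose k := 'i%C *: d.
have kk : k * k = - (d * d) by rewrite multZAl multZAr scalerA mulc_ii scaleN1r.
have -> : T * star T = 2 *r (h * h + k * k) + p.
  have -> : p = - (star T * T) by rewrite TT opprK.
  rewrite kk /h /d !multZAl !multZAr.
  by rewrite !mulrDl !mulrDr !mulrN !mulNr; linear_ring R.
have hs : star h = h by rewrite /h starR starD starK; linear_ring R.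
have ks : star k = k.
  by rewrite /k /d starZ starR starB starK conjc_i; linear_ring R.
by apply: mposD => //; apply: mposR => //; apply: mposD;
  [exists h|exists k]; rewrite ?hs ?ks.
Qed.

(** All the terms of the binomial expansion of (1 + s p) ^ n p are positive. *)
Lemma mpos_pow_lower (s : R) p n : 0 <= s -> mpos p ->
  exists v, [/\ mpos v, v * p = p * v &
    (1 + s *r p) ^+ n * p = (n%:R * s) *r (p * p) + (v + p)].
Proof.
move=> s0 pp; have p2 : mpos (p * p) by exists p; rewrite mpos_star.
elim: n => [|n [v [pv vp vE]]].
  exists 0; split; [by exists 0; rewrite star0 mulr0|by rewrite mulr0 mul0r|].
  by rewrite expr0 mul1r mul0r scale0r !add0r.
exists (v + (s *r (p * v) + (n%:R * s * s) *r (p * (p * p)))); split.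
- apply: mposD => //; apply: mposD; apply: mposR; rewrite ?mulr_ge0//.
    exact: mposM.
  by apply: mposM; rewrite ?mulrA.
- by rewrite !mulrDl !mulrDr !multZAl !multZAr vp -!mulrA vp.
- rewrite exprS -mulrA vE mulrDl mul1r multZAl !mulrDr multZAr.
  by rewrite -natr1; linear_ring R.
Qed.

(** If T^* T = - p with p positive, then T T^* is positive, and W = 1 - s T T^*
    has norm at most 1 for a suitable s > 0. Hence T^* W ^ n T, which is
    - (1 + s p) ^ n p, is bounded independently of n; but (1 + s p) ^ n p
    dominates n s p ^ 2. This replaces the usual argument that T^* T and T T^*
    have the same spectrum up to 0. *)
Lemma star_sq_neg_eq0 T p : star T * T = - p -> mpos p -> p = 0.
Proof.
move=> TT pp; have [r r0 qr] := mpos_bd (mul_star_pos TT pp).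
have s0 : 0 < r^-1 by rewrite invr_gt0.
pose s := r^-1; pose W : M := 1 - s *r (T * star T).
have W1 : mbd W 1.
  have -> : W = s *r (r *r 1 - T * star T).
    by rewrite /W scalerBr real_scaleA mulVf ?scale1r// gt_eqF.
  by apply: (mbdW _ (mbdR (ltW s0) qr)); rewrite mulVf ?gt_eqF.
have TW n : star T * W ^+ n = (1 + s *r p) ^+ n * star T.
  elim: n => [|n IH]; first by rewrite !expr0 mul1r mulr1.
  rewrite exprSr mulrA IH exprSr -!mulrA; congr (_ * _).
  rewrite /W mulrBr mulr1 mulrDl mul1r multZAl multZAr mulrA TT mulNr.
  by linear_ring R.
have [c c0 Tc] := mbd_exists T; have cc : 0 < c * c by rewrite mulr_gt0.
have bd n : mbd ((1 + s *r p) ^+ n * p) (c * c).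
  have -> : (1 + s *r p) ^+ n * p = - (star T * W ^+ n * T).
    by rewrite TW -mulrA TT mulrN opprK.
  apply: mbdN; apply: mbdM => //; first exact: ltW.
  rewrite -[c]mulr1; apply: mbdM; [exact: ltW|exact: mbd_star|].
  by have := mbdX n ler01 W1; rewrite expr1n.
have p2 : mpos (p * p) by exists p; rewrite mpos_star.
suff : p * p = 0 by rewrite -{1}(mpos_star pp) => /star_sq_eq0.
apply: mbd_eq0 => e e0.
have := archi_boundP (ltW (divr_gt0 cc (mulr_gt0 e0 s0))).
set n := Num.bound _ => hn.
have n0 : 0 < n%:R :> R.
  by apply: le_lt_trans hn; rewrite ltW// divr_gt0// mulr_gt0.
have ns : 0 < n%:R * s by rewrite mulr_gt0.
have [v [pv vp vE]] := mpos_pow_lower n (ltW s0) pp.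
have := bd n; rewrite vE => /(mpos_le_bd cc (mposR (ltW ns) p2) (mposD pv pp)).
have nsi : 0 <= (n%:R * s)^-1 by rewrite invr_ge0 ltW.
move=> /(mbdR nsi); rewrite real_scaleA mulVf ?scale1r ?gt_eqF//.
apply: mbdW; rewrite ler_pdivrMl//.
by rewrite ltr_pdivrMr ?mulr_gt0// in hn; rewrite /s; lra.
Qed.

(** Let x = T^* T, let g be the root of x ^ 2, the absolute value of x, and let
    m = (g - x) / 2 be the negative part of x. Then (T m)^* (T m) = m x m
    is - g m ^ 2, so that g m ^ 2 = 0 by the preceding lemma and m = 0. *)
Theorem star_sq_pos T : mpos (star T * T).
Proof.
set x := star T * T; have sx : star x = x by rewrite /x starM starK.
have [|g [sg gx bg pg]] := @mpos_root _ _ (x * x); first by exists x.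
have xg : x * g = g * x by apply: bg; rewrite mulrA.
pose m := 2^-1 *r (g - x).
have sm : star m = m by rewrite starR starB sg sx.
have gm : g * m = m * g by rewrite multZAr multZAl mulrBr mulrBl xg.
have xm : x * m = - (g * m).
  by rewrite !multZAr !mulrBr xg gx; linear_ring R.
have mm : m * m = g * m.
  rewrite [LHS]multZAl mulrBl xm opprK; linear_ring R.
have TmTm : star (T * m) * (T * m) = - (g * (m * m)).
  by rewrite starM sm -mulrA (mulrA (star T)) -/x xm mulrN mulrA gm -mulrA gm.
have pm : mpos (g * (m * m)).
  by apply: mposM => //; [exists m|rewrite mulrA gm -!mulrA gm].
have m3 : m * m * m = 0.
  by rewrite mm -mulrA; exact: star_sq_neg_eq0 TmTm pm.
have m2 : m * m = 0.
  by apply: star_sq_eq0; rewrite starM sm mulrA m3 mul0r.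
have m0 : m = 0 by apply: star_sq_eq0; rewrite sm.
suff -> : x = g by [].
have -> : x = g - 2 *r m by rewrite /m; linear_ring R.
by rewrite m0 scaler0 subr0.
Qed.

End StarSquares.

Section PositiveSums.
Context {R : realType} {A : cstarAlgType R}.
Implicit Types a b : A.

Lemma lmul_adj a b c :
  cmul (cstar (cmul a b)) c = cmul (cstar b) (cmul (cstar a) c).
Proof. by rewrite cstarM cmulA. Qed.

Lemma lmul_bounded a : exists c : R, forall b, nrm (cmul a b) <= c * nrm b.
Proof. by exists (nrm a) => b; exact: nrm_cmul. Qed.

Definition lmul a : multiplier A := Multiplier (lmul_adj a) (lmul_bounded a).

(** Left multiplication embeds A in its multipliers and turns a^* a into a
    positive multiplier. *)
Theorem nrm_star_sq_le a b :
  nrm (cmul (cstar a) a) <= nrm (cmul (cstar a) a + cmul (cstar b) b).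
Proof.
set x := cmul (cstar a) a; set y := x + _.
apply/ler_addgt0Pr => e e0; set c := nrm y + e.
have c0 : 0 < c by have := nrm_ge0 y; rewrite /c; lra.
have xy : star (lmul a) * lmul a + star (lmul b) * lmul b = lmul y.
  by apply: mult_ext => z /=; rewrite !cmulA -cmulDl.
have yc : mbd (star (lmul a) * lmul a + star (lmul b) * lmul b) c.
  rewrite xy => z /=; apply: (le_trans (nrm_cmul _ _)).
  by rewrite ler_wpM2r ?nrm_ge0// /c lerDl ltW.
have /(_ x) := mpos_le_bd c0 (star_sq_pos (lmul a)) (star_sq_pos (lmul b)) yc.
have sx : cstar x = x by rewrite /x cstarM cstarK.
rewrite /= cmulA -/x -{1}sx nrm_cstar_sq; have [->|x0] := eqVneq (nrm x) 0.
  by move=> _; exact: ltW.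
by rewrite expr2 ler_pM2r// lt_neqAle eq_sym x0 nrm_ge0.
Qed.

End PositiveSums.

(** * Hilbert modules and compact operators *)

Section InnerProductModules.
Context {R : realType} {A : cstarAlgType R} {E : innerProductModType A}.
Implicit Types (x y z : E) (a : A) (k : R[i]).
Local Notation "<< x , y >>" := (iprod x y : A).

Lemma iprodDl x y z : << x + y, z >> = << x, z >> + << y, z >>.
Proof. by rewrite -iprodC iprodDr cstarD !iprodC. Qed.

Lemma iprodZl k x y : << k *: x, y >> = conjc k *: << x, y >>.
Proof. by rewrite -iprodC iprodZr cstarZ iprodC. Qed.

Lemma iprod0r x : << x, 0 >> = 0.
Proof. by apply: (addrI << x, 0 >>); rewrite -iprodDr !addr0. Qed.

Lemma iprod0l x : << 0, x >> = 0.
Proof. by rewrite -iprodC iprod0r cstar0. Qed.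

Lemma iprodNr x y : << x, - y >> = - << x, y >>.
Proof. by apply: (addrI << x, y >>); rewrite -iprodDr !subrr iprod0r. Qed.

Lemma iprodNl x y : << - x, y >> = - << x, y >>.
Proof. by rewrite -iprodC iprodNr cstarN iprodC. Qed.

Lemma iprodBr x y z : << x, y - z >> = << x, y >> - << x, z >>.
Proof. by rewrite iprodDr iprodNr. Qed.

Lemma iprodBl x y z : << x - y, z >> = << x, z >> - << y, z >>.
Proof. by rewrite iprodDl iprodNl. Qed.

Lemma iprod_ractl x y a : << ract x a, y >> = cmul (cstar a) << x, y >>.
Proof. by rewrite -iprodC iprod_ract cstarM iprodC. Qed.

Lemma ipnorm_sq x : ipnorm x ^+ 2 = nrm << x, x >>.
Proof. by rewrite /ipnorm -/(nrm _) sqr_sqrtr// nrm_ge0. Qed.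

Lemma ipnorm_ge0 x : 0 <= ipnorm x.
Proof. exact: sqrtr_ge0. Qed.

End InnerProductModules.

Section HilbertModules.
Context {R : realType} {A : cstarAlgType R}.
Implicit Types (E F : hilbertModType A).
Local Notation "<< x , y >>" := (iprod x y : A).

Lemma nrm_iprod E (x : E) : nrm << x, x >> = nrm x ^+ 2.
Proof. by apply: complexI; have := iprod_normE x; rewrite -!nrmE rmorphXn. Qed.

Lemma ipnormE E (x : E) : ipnorm x = nrm x.
Proof. by rewrite /ipnorm -/(nrm _) nrm_iprod sqrtr_sqr ger0_norm ?nrm_ge0. Qed.

Lemma iprod_eq0 E (x : E) : << x, x >> = 0 -> x = 0.
Proof.
move=> x0; apply: nrm_eq0; apply/eqP.
by rewrite -sqrf_eq0 -nrm_iprod x0 nrm0.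
Qed.

Lemma nrm_le_iprodD E F (x : E) (y : F) :
  nrm x ^+ 2 <= nrm (<< x, x >> + << y, y >>).
Proof.
have [[b xb] [c yc]] := (iprod_ge0 x, iprod_ge0 y).
by rewrite -nrm_iprod xb yc; exact: nrm_star_sq_le.
Qed.

Lemma nrm_iprodD_le E F (x : E) (y : F) :
  nrm (<< x, x >> + << y, y >>) <= (nrm x + nrm y) ^+ 2.
Proof.
apply: (le_trans (nrmD _ _)); rewrite !nrm_iprod.
by have := nrm_ge0 x; have := nrm_ge0 y; nra.
Qed.

(** Cauchy-Schwarz, from the monotonicity of the norm applied to the identity
    4 k a a^* + <k x - z, k x - z> = <k x + z, k x + z> with a = <x, y>,
    z = y a^* and k chosen to balance k x and z. *)
Theorem cauchy_schwarz E (x y : E) : nrm << x, y >> <= nrm x * nrm y.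
Proof.
set a := << x, y >>; pose z := ract y (cstar a).
have xz : << x, z >> = cmul a (cstar a) by rewrite iprod_ract.
have zx : << z, x >> = cmul a (cstar a) by rewrite -iprodC xz cstarM cstarK.
have za : nrm z <= nrm y * nrm a.
  rewrite -ler_sqr ?nnegrE ?mulr_ge0 ?nrm_ge0// -nrm_iprod.
  rewrite iprod_ract iprod_ractl cstarK.
  apply: (le_trans (nrm_cmul _ _)); rewrite nrm_cstar.
  have := nrm_cmul a << y, y >>; rewrite nrm_iprod => h.
  by apply: (le_trans (ler_wpM2r (nrm_ge0 a) h)); lra.
have key (k : R) : 0 <= k ->
    4 * k * nrm a ^+ 2 <= (k * nrm x + nrm y * nrm a) ^+ 2.
  move=> k0; pose u := k%:C%C *: x - z; pose v := k%:C%C *: x + z.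
  pose b := (2 * Num.sqrt k)%:C%C *: cstar a.
  have bb : cmul (cstar b) b = (4 * k)%:C%C *: cmul a (cstar a).
    rewrite /b cstarZ cstarK conjc_real -cscaleAl -cscaleAr scalerA -rmorphM.
    by rewrite mulrACA sqrt_mul_sqrt// -natrM.
  have uv : cmul (cstar b) b + << u, u >> = << v, v >>.
    rewrite bb /u /v !(iprodBl, iprodBr, iprodDl, iprodDr, iprodZl, iprodZr).
    by rewrite xz zx !conjc_real; linear_ring R.
  have [c uc] := iprod_ge0 u; have := nrm_star_sq_le b c.
  rewrite -uc uv nrm_iprod nrm_cstar_sq => h.
  have b2 : nrm b ^+ 2 = 4 * k * nrm a ^+ 2.
    rewrite /b nrmZ Re_norm_real nrm_cstar exprMn real_normK ?num_real//.
    by rewrite exprMn sqr_sqrtr// -natrX.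
  rewrite -b2; apply: (le_trans h); rewrite ler_sqr ?nnegrE ?nrm_ge0//.
    apply: (le_trans (nrmD _ _)); rewrite nrmZ Re_norm_real ger0_norm//.
    by rewrite lerD2l.
  by rewrite addr_ge0 ?mulr_ge0 ?nrm_ge0.
have [x0|x0] := eqVneq (nrm x) 0.
  by rewrite /a (nrm_eq0 x0) iprod0l !nrm0 mul0r.
have x1 : 0 < nrm x by rewrite lt_neqAle eq_sym x0 nrm_ge0.
have [|a0] := lerP (nrm a) 0.
  by move=> /le_trans; apply; rewrite mulr_ge0 ?nrm_ge0.
have [y0|y0] := eqVneq (nrm y) 0.
  by rewrite /a (nrm_eq0 y0) iprod0r !nrm0 mulr0.
have y1 : 0 < nrm y by rewrite lt_neqAle eq_sym y0 nrm_ge0.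
have k0 : 0 <= nrm y * nrm a / nrm x by rewrite divr_ge0 ?mulr_ge0 ?nrm_ge0.
have := key _ k0; rewrite mulfVK//.
rewrite mulrA mulrAC ler_pdivrMr// => h.
have p : 0 < 4 * (nrm y * nrm a ^+ 2) by rewrite !mulr_gt0// exprn_gt0.
have g : (4 * (nrm y * nrm a ^+ 2)) * (nrm x * nrm y - nrm a) >= 0 by lra.
by rewrite pmulr_rge0// subr_ge0 in g.
Qed.

Lemma iprod_inj E (x y : E) : (forall z, << z, x >> = << z, y >>) -> x = y.
Proof.
move=> xy; apply/eqP; rewrite -subr_eq0; apply/eqP/iprod_eq0.
by rewrite iprodBr xy subrr.
Qed.

(** Linearity over the complex numbers and over A follows from the existence of
    an adjoint. *)
Lemma adjointable_of_adjoint E (f g : E -> E) (c : R) :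
  (forall x y, << f x, y >> = << x, g y >>) ->
  (forall x, nrm (f x) <= c * nrm x) ->
  exists T : adjointable E E, forall x, T x = f x.
Proof.
move=> fg fc.
have gf x y : << x, f y >> = << g x, y >>.
  by rewrite -iprodC fg iprodC.
have lf : linear f.
  by move=> k x y; apply: iprod_inj => z; rewrite !(gf, iprodDr, iprodZr).
pose F : {linear E -> E} := HB.pack f (GRing.isLinear.Build _ _ _ _ f lf).
have Fr x a : F (ract x a) = ract (F x) a.
  by apply: iprod_inj => z; rewrite /= !(gf, iprod_ract).
have Fb : exists c : R, forall x, ipnorm (F x) <= c * ipnorm x.
  by exists c => x; rewrite !ipnormE; exact: fc.
have Fa : exists S : E -> E, forall x y, << F x, y >> = << x, S y >>.
  by exists g.
by exists (Adjointable Fr Fb Fa).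
Qed.

Lemma adjointable_nrm E (T : adjointable E E) :
  exists2 c : R, 0 < c & forall x, nrm (T x) <= c * nrm x.
Proof.
have [c Tc] := adjointable_bounded T; exists (`|c| + 1).
  by rewrite ltr_wpDl.
move=> x; rewrite -!ipnormE; apply: (le_trans (Tc x)).
by rewrite ler_wpM2r ?ipnorm_ge0// ler_wpDr// ler_norm.
Qed.

End HilbertModules.

Section CompactOperators.
Context {R : realType} {A : cstarAlgType R}.
Local Notation "<< x , y >>" := (iprod x y : A).

Lemma compact_op_ext (G E : innerProductModType A) (T S : G -> E) :
  (forall x, T x = S x) -> compact_op T -> compact_op S.
Proof. by move=> /funext ->. Qed.

Lemma compact_opD (G : innerProductModType A) (E : hilbertModType A)
    (T S : G -> E) :
  compact_op T -> compact_op S -> compact_op (fun x => T x + S x).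
Proof.
move=> cT cS e e0; have e2 : 0 < e / 2 by lra.
have [[s sP] [r rP]] := (cT _ e2, cS _ e2); exists (s ++ r) => z.
rewrite big_cat /= opprD addrACA ipnormE.
have := sP z; have := rP z; rewrite !ipnormE => h1 h2.
apply: (le_trans (nrmD _ _)); lra.
Qed.

Lemma compact_op_comp_left (G : innerProductModType A) (E : hilbertModType A)
    (Q : adjointable E E) (T : G -> E) :
  compact_op T -> compact_op (fun x => Q (T x)).
Proof.
move=> cT e e0; have [c c0 Qc] := adjointable_nrm Q.
have [s sP] := cT _ (divr_gt0 e0 c0); exists [seq (Q p.1, p.2) | p <- s] => z.
rewrite big_map /= ipnormE.
have -> : Q (T z) - \sum_(p <- s) ract (Q p.1) << p.2, z >> =
    Q (T z - \sum_(p <- s) ract p.1 << p.2, z >>).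
  rewrite linearB [X in _ = _ - X]linear_sum; congr (_ - _).
  apply: eq_bigr => p _.
  by rewrite adjointable_ract.
apply: (le_trans (Qc _)); have := sP z; rewrite ipnormE.
move=> /(ler_wpM2l (ltW c0)) /le_trans; apply.
by rewrite mulrA mulrCA divff ?mulr1 ?gt_eqF.
Qed.

Lemma compact_op_comp_right (F G E : innerProductModType A) (f : F -> G)
    (f' : G -> F) (c : R) (T : G -> E) : 0 < c ->
  (forall x y, << y, f x >> = << f' y, x >>) ->
  (forall x, ipnorm (f x) <= c * ipnorm x) ->
  compact_op T -> compact_op (fun x => T (f x)).
Proof.
move=> c0 ff' fc cT e e0.
have [s sP] := cT _ (divr_gt0 e0 c0); exists [seq (p.1, f' p.2) | p <- s] => z.
rewrite big_map /=.
under eq_bigr do rewrite -ff'.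
apply: (le_trans (sP _)); apply: (le_trans (ler_wpM2l _ (fc z))).
  by rewrite ltW ?divr_gt0.
by rewrite mulrA divfK ?gt_eqF.
Qed.

Lemma iprod_suml (E : innerProductModType A) I (s : seq I) (F : I -> E) x :
  << \sum_(i <- s) F i, x >> = \sum_(i <- s) << F i, x >>.
Proof.
elim: s => [|i s IH]; first by rewrite !big_nil iprod0l.
by rewrite !big_cons iprodDl IH.
Qed.

Lemma iprod_sumr (E : innerProductModType A) I (s : seq I) (F : I -> E) x :
  << x, \sum_(i <- s) F i >> = \sum_(i <- s) << x, F i >>.
Proof.
elim: s => [|i s IH]; first by rewrite !big_nil iprod0r.
by rewrite !big_cons iprodDr IH.
Qed.

(** An operator and its adjoint have the same norm, and the adjoint of
    x |-> a <b, x> is x |-> b <a, x>. *)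
Lemma compact_op_adjoint (E : hilbertModType A) (T S : E -> E) :
  (forall x y, << T x, y >> = << x, S y >>) -> compact_op T -> compact_op S.
Proof.
move=> TS cT e e0; have [s sP] := cT e e0.
exists [seq (p.2, p.1) | p <- s] => z.
rewrite big_map /= !ipnormE.
pose D x := T x - \sum_(p <- s) ract p.1 << p.2, x >>.
set w := S z - _.
have wD : << w, w >> = << D w, z >>.
  rewrite [LHS]iprodBr [RHS]iprodBl TS; congr (_ - _).
  rewrite iprod_sumr iprod_suml; apply: eq_bigr => p _.
  by rewrite iprod_ract iprod_ractl iprodC.
have [w0|w0] := eqVneq (nrm w) 0; first by rewrite w0 mulr_ge0 ?nrm_ge0 ?ltW.
have w1 : 0 < nrm w by rewrite lt_neqAle eq_sym w0 nrm_ge0.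
rewrite -(ler_pM2l w1) -expr2 -nrm_iprod wD.
apply: (le_trans (cauchy_schwarz _ _)); have := sP w; rewrite !ipnormE -/(D w).
by move=> /(ler_wpM2r (nrm_ge0 z)) /le_trans; apply; lra.
Qed.

End CompactOperators.

(** * Selfadjoint graphs and their resolvents *)

Section Topology.
Context {R : realType} {V : completeNormedModType R[i]}.
Implicit Types (S : set (V * V)) (D : set V) (x y : V) (p q : V * V) (e : R).

Lemma ball_nrm x y e : ball x e%:C%C y = (nrm (x - y) < e) :> Prop.
Proof. by rewrite -ball_normE /= -nrmE ltcR. Qed.

Lemma gt0_real (e : R[i]) : 0 < e -> exists2 r : R, 0 < r & e = r%:C%C.
Proof.
move=> e0; exists (complex.Re e); last by rewrite RRe_real// gtr0_real.
by move: e0; rewrite ltcE => /andP[].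
Qed.

Lemma closure_nrm S p : closure S p <->
  forall e, 0 < e ->
    exists2 q, S q & nrm (p.1 - q.1) < e /\ nrm (p.2 - q.2) < e.
Proof.
split=> [pS e e0|h B /nbhs_ballP[_ /gt0_real[e e0 ->] eB]].
  have ec : (0 : R[i]) < e%:C%C by rewrite ltcR.
  have [q [Sq []]] := pS _ (nbhsx_ballx p _ ec).
  by rewrite !ball_nrm; exists q.
have [q Sq [q1 q2]] := h _ e0; exists q; split=> //; apply: eB.
by split; rewrite ball_nrm.
Qed.

Lemma dense_nrm D : dense D <->
  forall x e, 0 < e -> exists2 y, D y & nrm (x - y) < e.
Proof.
split=> [dD x e e0|h O [x Ox] oO].
  have ec : (0 : R[i]) < e%:C%C by rewrite ltcR.
  have [|y [/interior_subset xy Dy]] :=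
      dD (ball x e%:C%C)^° _ (open_interior _).
    by exists x; exact: nbhsx_ballx.
  by exists y; rewrite // -ball_nrm.
have /nbhs_ballP[_ /gt0_real[e e0 ->] eO] : nbhs x O by exact: open_nbhs_nbhs.
have [y Dy xy] := h x e e0; exists y; split=> //; apply: eO.
by rewrite ball_nrm.
Qed.

End Topology.

Section Graphs.
Context {R : realType} {A : cstarAlgType R} {E : hilbertModType A}.
Local Notation "<< x , y >>" := (iprod x y : A).
Implicit Types (S : set (E * E)) (B : E -> E) (k : R[i]) (p q : E * E).

Definition graph_plus S B : set (E * E) := [set p | S (p.1, p.2 - B p.1)].

(** Selfadjoint operators are handled through their graphs, as relations on E,
    so that domains need not be mentioned. *)
Definition sa_graph S := S = adjoint_graph S.

Definition symmetric_map B := forall x y, << B x, y >> = << x, B y >>.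

Lemma sa_graph_sym S : sa_graph S ->
  forall p q, S p -> S q -> << p.2, q.1 >> = << p.1, q.2 >>.
Proof. by move=> sS p q Sp; rewrite {1}sS; apply. Qed.

Lemma sa_graphD S p q : sa_graph S -> S p -> S q -> S (p + q).
Proof.
move=> sS Sp Sq; rewrite sS => r Sr /=.
by rewrite !iprodDr !(sa_graph_sym sS Sr).
Qed.

Lemma sa_graphZ S k p : sa_graph S -> S p -> S (k *: p).
Proof.
move=> sS Sp; rewrite sS => r Sr /=.
by rewrite !iprodZr !(sa_graph_sym sS Sr).
Qed.

Lemma sa_graphB S p q : sa_graph S -> S p -> S q -> S (p - q).
Proof.
by move=> sS Sp Sq; rewrite -scaleN1r; apply: sa_graphD; last apply: sa_graphZ.
Qed.

Lemma sa_graph0 S : sa_graph S -> S 0.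
Proof. by move=> -> r Sr /=; rewrite !iprod0r. Qed.

Lemma sa_graph_closed S p : sa_graph S -> closure S p -> S p.
Proof.
move=> sS /closure_nrm cp; rewrite sS => r Sr; apply/eqP; rewrite -subr_eq0.
apply/eqP/nrm_le_eq0 => e e0.
have [r1 r2] := (nrm_ge0 r.1, nrm_ge0 r.2).
set c := nrm r.1 + nrm r.2 + 1; have c0 : 0 < c by rewrite /c; lra.
have [q Sq [q1 q2]] := cp _ (divr_gt0 e0 c0).
have -> : << r.2, p.1 >> - << r.1, p.2 >> =
    << r.2, p.1 - q.1 >> - << r.1, p.2 - q.2 >>.
  by rewrite !iprodBr (sa_graph_sym sS Sr Sq); linear_ring R.
apply: (le_trans (nrmB _ _)).
have h1 := le_trans (cauchy_schwarz r.2 (p.1 - q.1)) (ler_wpM2l r2 (ltW q1)).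
have h2 := le_trans (cauchy_schwarz r.1 (p.2 - q.2)) (ler_wpM2l r1 (ltW q2)).
apply: (le_trans (lerD h1 h2)); rewrite -mulrDl mulrA ler_pdivrMr// mulrC.
by rewrite ler_pM2l// /c; lra.
Qed.

(** The term <B q, p> moves to the other side of the equation that defines the
    adjoint, so the adjoint of S + B is the adjoint of S plus B. *)
Lemma sa_graph_plus S B :
  sa_graph S -> symmetric_map B -> sa_graph (graph_plus S B).
Proof.
move=> sS sB; apply/seteqP; split=> p pS.
  move=> q Sq; have := sa_graph_sym sS Sq pS.
  rewrite /= iprodBl iprodBr sB => h.
  exact: (addIr (- << q.1, B p.1 >>)).
rewrite /graph_plus /= sS => q Sq; rewrite /= iprodBr -sB.
have /= <- := pS (q.1, q.2 + B q.1); first by rewrite iprodDl addrK.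
by rewrite /graph_plus /= addrK; case: q Sq.
Qed.

(** Both i and - i are needed, and all arguments are the same for the two. *)
Definition imaginary_unit k := conjc k = - k /\ k * k = -1.

Lemma imaginary_unit_i : imaginary_unit 'i%C.
Proof. by split; [exact: conjc_i|exact: mulc_ii]. Qed.

Lemma imaginary_unitN k : imaginary_unit k -> imaginary_unit (- k).
Proof. case=> ck kk; split; last by rewrite mulrNN.
by have -> : conjc (- k) = - conjc k := rmorphN _ k; rewrite ck. Qed.

Lemma imaginary_unit_norm k : imaginary_unit k -> complex.Re `|k| = 1.
Proof.
move=> [_ kk]; have : `|k| ^+ 2 = 1 by rewrite -normrX expr2 kk normrN1.
by move=> /eqP; rewrite sqrp_eq1// => /eqP ->.
Qed.

(** The mixed terms cancel; with the monotonicity of the norm this bounds both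
    components of a point p of the graph by (S + k) p. *)
Lemma iprod_resolvent S k p : sa_graph S -> imaginary_unit k -> S p ->
  << p.2 + k *: p.1, p.2 + k *: p.1 >> = << p.2, p.2 >> + << p.1, p.1 >>.
Proof.
move=> sS [ck kk] Sp.
rewrite !(iprodDl, iprodDr, iprodZl, iprodZr) (sa_graph_sym sS Sp Sp).
by rewrite scalerA ck mulNr kk; linear_ring R.
Qed.

Lemma resolvent_bd2 S k p : sa_graph S -> imaginary_unit k -> S p ->
  nrm p.2 <= nrm (p.2 + k *: p.1).
Proof.
move=> sS hk Sp; rewrite -ler_sqr ?nnegrE ?nrm_ge0//.
by rewrite -(nrm_iprod (_ + _)) (iprod_resolvent sS hk Sp) nrm_le_iprodD.
Qed.

Lemma resolvent_bd1 S k p : sa_graph S -> imaginary_unit k -> S p ->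
  nrm p.1 <= nrm (p.2 + k *: p.1).
Proof.
move=> sS hk Sp; rewrite -ler_sqr ?nnegrE ?nrm_ge0//.
by rewrite -(nrm_iprod (_ + _)) (iprod_resolvent sS hk Sp) addrC nrm_le_iprodD.
Qed.

Definition shift_onto S k := forall y, exists2 p, S p & p.2 + k *: p.1 = y.

(** Solving S x + k x = y up to half of the norm of y and repeating with the
    remainder solves it exactly. *)
Lemma shift_onto_approx S k : sa_graph S -> imaginary_unit k ->
  (forall y, exists2 p, S p & nrm (y - (p.2 + k *: p.1)) <= nrm y / 2) ->
  shift_onto S k.
Proof.
move=> sS hk happ y.
have /choice[f fP] : forall y, exists p,
    S p /\ nrm (y - (p.2 + k *: p.1)) <= nrm y / 2.
  by move=> z; have [p] := happ z; exists p.
pose L p := p.2 + k *: p.1.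
have LB p q : L (p - q) = L p - L q by rewrite /L /=; linear_ring R.
pose P := fix P n := if n is n'.+1 then P n' + f (y - L (P n')) else 0.
have SP n : S (P n).
  elim: n => [|n IH] /=; first exact: sa_graph0.
  by apply: sa_graphD => //; case: (fP (y - L (P n))).
pose d n : R := nrm y * 2^-1 ^+ n.
have dS n : d n.+1 = d n / 2 by rewrite /d exprSr mulrA.
have d0 n : 0 <= d n by rewrite mulr_ge0 ?nrm_ge0// exprn_ge0.
have Pd n : nrm (y - L (P n)) <= d n.
  elim: n => [|n IH]; first by rewrite /d /= /L /= scaler0 addr0 subr0 mulr1.
  have [_] := fP (y - L (P n)); rewrite -/(L _) dS => h.
  have -> : y - L (P n.+1) = y - L (P n) - L (f (y - L (P n))).
    by rewrite /= /L /=; linear_ring R.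
  by apply: (le_trans h); rewrite ler_pM2r.
have dn n m : (n <= m)%N -> d m <= d n.
  move=> /subnKC <-; elim: (m - n)%N => [|j IH]; first by rewrite addn0.
  by rewrite addnS dS; have := d0 (n + j)%N; lra.
have PP n m : (n <= m)%N -> nrm (L (P m - P n)) <= 2 * d n.
  move=> nm; have -> : L (P m - P n) = (y - L (P n)) - (y - L (P m)).
    by rewrite LB; linear_ring R.
  apply: (le_trans (nrmB _ _)).
  by have := Pd n; have := Pd m; have := dn _ _ nm; lra.
have d20 e : 0 < e -> exists n, 2 * d n < e.
  move=> e0; have e1 : 0 < 2 * nrm y + 1 by have := nrm_ge0 y; lra.
  have := archi_boundP (ltW (divr_gt0 e1 e0)); set n := Num.bound _ => hn.
  exists n; rewrite /d exprVn mulrA ltr_pdivrMr ?exprn_gt0//.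
  have : n%:R < 2 ^+ n :> R by rewrite -natrX ltr_nat ltn_expl.
  rewrite ltr_pdivrMr// mulrC in hn => h2.
  by apply: lt_trans (_ : e * n%:R < _); [lra|rewrite ltr_pM2l].
have [x1 x1P] : exists l, forall n, nrm ((P n).1 - l) <= 2 * d n.
  apply: nrm_cauchy_lim => // n m nm; apply: le_trans (PP _ _ nm).
  by apply: (resolvent_bd1 sS hk (p := P m - P n)); exact: sa_graphB.
have [x2 x2P] : exists l, forall n, nrm ((P n).2 - l) <= 2 * d n.
  apply: nrm_cauchy_lim => // n m nm; apply: le_trans (PP _ _ nm).
  by apply: (resolvent_bd2 sS hk (p := P m - P n)); exact: sa_graphB.
exists (x1, x2).
  apply: sa_graph_closed => //; apply/closure_nrm => e /d20[n dne].
  by exists (P n) => //; rewrite /= (nrm_distC x1) (nrm_distC x2);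
     split; apply: le_lt_trans dne.
apply/esym/eqP; rewrite -subr_eq0; apply/eqP/nrm_le_eq0 => e e0.
have e5 : 0 < e / 5 by lra.
have [n dne] := d20 _ e5.
have -> : y - ((x1, x2).2 + k *: (x1, x2).1) =
   (y - L (P n)) + (((P n).2 - x2) + k *: ((P n).1 - x1)).
  by rewrite /L /=; linear_ring R.
apply: (le_trans (nrmD _ _)); apply: (le_trans (lerD (Pd n) (nrmD _ _))).
rewrite nrmZ (imaginary_unit_norm hk) mul1r.
by have := x1P n; have := x2P n; have := d0 n; lra.
Qed.

(** The solution for S solves the equation for S + B up to B p.1, and p.1 is
    bounded by the right-hand side. *)
Lemma shift_onto_perturb S B k : sa_graph S -> symmetric_map B ->
  imaginary_unit k -> (forall x, nrm (B x) <= nrm x / 2) ->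
  shift_onto S k -> shift_onto (graph_plus S B) k.
Proof.
move=> sS sB hk Bh Sk; apply: shift_onto_approx => // [|y].
  exact: sa_graph_plus.
have [p Sp py] := Sk y; exists (p.1, p.2 + B p.1).
  by rewrite /graph_plus /= addrK; case: p Sp {py}.
have -> : y - ((p.1, p.2 + B p.1).2 + k *: (p.1, p.2 + B p.1).1) = - B p.1.
  by rewrite -py /=; linear_ring R.
rewrite nrmN; apply: (le_trans (Bh _)); rewrite ler_pM2r//.
by rewrite -py; exact: resolvent_bd1 sS hk Sp.
Qed.

(** B is added in N equal pieces of norm at most 1/2. The bounds on the
    resolvent do not deteriorate along the way because the sums stay selfadjoint. *)
Lemma shift_onto_plus S B k (c : R) : sa_graph S -> symmetric_map B ->
  imaginary_unit k -> (forall x, nrm (B x) <= c * nrm x) ->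
  shift_onto S k -> shift_onto (graph_plus S B) k.
Proof.
move=> sS sB hk Bc Sk; pose N := (Num.bound (2 * c)).+1.
have N0 : 0 < N%:R :> R by rewrite ltr0n.
have cN : c / N%:R <= 2^-1.
  rewrite ler_pdivrMr//; have [c0|c0] := lerP 0 (2 * c); last first.
    by have := ltW N0; lra.
  rewrite /N -(addn1 (Num.bound _)) natrD; have := archi_boundP c0.
  by move: ((Num.bound (2 * c))%:R : R) => x; lra.
pose D (a : R) x := a%:C%C *: B x.
have sD a : symmetric_map (D a).
  by move=> x y; rewrite iprodZl iprodZr conjc_real sB.
have DN : B = D (N%:R / N%:R).
  by apply/funext => x; rewrite /D divff ?gt_eqF// scale1r.
rewrite DN; elim: {DN}(X in D (X%:R / _)) => [|j IH].
  have -> // : graph_plus S (D (0%:R / N%:R)) = S.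
  by apply/funext => -[x y]; rewrite /graph_plus /D mul0r /= scale0r subr0.
have -> : graph_plus S (D (j.+1%:R / N%:R)) =
    graph_plus (graph_plus S (D (j%:R / N%:R))) (D (1 / N%:R)).
  apply/funext => p; rewrite /graph_plus /=; congr (S (_, _)).
  by rewrite /D -(natr1 j); linear_ring R.
apply: shift_onto_perturb => //; first exact: sa_graph_plus.
move=> x; rewrite /D nrmZ Re_norm_real ger0_norm ?divr_ge0//.
apply: (@le_trans _ _ (c / N%:R * nrm x)).
  by rewrite div1r (mulrC c) -mulrA ler_pM2l ?invr_gt0.
by rewrite [leRHS]mulrC ler_wpM2r ?nrm_ge0.
Qed.

End Graphs.

(** * Regularity and the gap metric *)

Section Regularity.
Context {R : realType} {A : cstarAlgType R} {E : hilbertModType A}.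
Local Notation "<< x , y >>" := (iprod x y : A).
Implicit Types (t : operator E) (T : adjointable E E) (k : R[i]).

Lemma graph_add_bounded t T : graph (add_bounded t T) = graph_plus (graph t) T.
Proof.
apply/seteqP; split=> [_ [x _ <-]|[u v] [x _ /= [xu tv]]].
  by exists x => //=; rewrite addrK.
by exists x => //=; rewrite xu tv subrK.
Qed.

(** The range of t + k contains that of 1 + t^* t = (t + k) (t - k). *)
Lemma regular_shift_onto t k : regular t -> selfadjoint t ->
  imaginary_unit k -> shift_onto (graph t) k.
Proof.
move=> [_ _ _ /dense_nrm dt] st hk; apply: shift_onto_approx => // y.
have [y0|y0] := eqVneq (nrm y) 0.
  by exists 0; [exact: sa_graph0|rewrite /= scaler0 addr0 subr0 y0 mul0r].
have y1 : 0 < nrm y / 2 by rewrite divr_gt0// lt_neqAle eq_sym y0 nrm_ge0.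
have [_ [[x z] /= [w xw wz] <-] yxz] := dt y _ y1.
rewrite -st in wz; exists ((w, z) - k *: (x, w)).
  by apply: sa_graphB => //; exact: sa_graphZ.
have [_ kk] := hk.
suff -> : ((w, z) - k *: (x, w)).2 + k *: ((w, z) - k *: (x, w)).1 = x + z.
  exact: ltW.
by rewrite /= scalerBr scalerA kk; linear_ring R.
Qed.

(** If t + i and t - i are onto, then so is their product 1 + t^* t. *)
Lemma regular_of_shift_onto t : selfadjoint t -> dense (fst @` graph t) ->
  shift_onto (graph t) 'i%C -> shift_onto (graph t) (- 'i%C) -> regular t.
Proof.
move=> st dt ti tNi; split => //.
- by move=> p; exact: sa_graph_closed.
- by rewrite -st.
apply/dense_nrm => y e e0; exists y; last by rewrite subrr nrm0.
have [p Sp <-] := ti y; have [q Sq qp] := tNi p.1.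
exists (q.1, p.2 + 'i%C *: q.2); last first.
  by rewrite /= -qp scalerDr scalerA mulrN mulc_ii; linear_ring R.
exists q.2; first by case: q Sq {qp}.
rewrite -st.
have -> : (q.2, (q.1, p.2 + 'i%C *: q.2).2) = p + 'i%C *: q.
  rewrite [RHS]surjective_pairing /=; congr pair.
  rewrite -qp; linear_ring R.
by apply: sa_graphD => //; exact: sa_graphZ.
Qed.

Lemma selfadjoint_add_bounded t T :
  selfadjoint t -> selfadjoint_bounded T -> selfadjoint (add_bounded t T).
Proof.
by move=> st sT; rewrite /selfadjoint graph_add_bounded; exact: sa_graph_plus.
Qed.

Lemma shift_onto_add_bounded t T k : regular t -> selfadjoint t ->
  selfadjoint_bounded T -> imaginary_unit k ->
  shift_onto (graph (add_bounded t T)) k.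
Proof.
move=> rt st sT hk; rewrite graph_add_bounded.
have [c _ Tc] := adjointable_nrm T.
by apply: (shift_onto_plus st sT hk Tc); exact: regular_shift_onto.
Qed.

Lemma regular_add_bounded t T : regular t -> selfadjoint t ->
  selfadjoint_bounded T -> regular (add_bounded t T).
Proof.
move=> rt st sT; apply: regular_of_shift_onto.
- exact: selfadjoint_add_bounded.
- have [_ dt _ _] := rt.
  suff -> : fst @` graph (add_bounded t T) = fst @` graph t by [].
  apply/seteqP; split=> _ [_ [x _ <-] <-] /=.
    by exists (\val x, t x) => //; exists x.
  by exists (\val x, t x + T (\val x)) => //; exists x.
- by apply: shift_onto_add_bounded => //; exact: imaginary_unit_i.
- apply: shift_onto_add_bounded => //.
  exact/imaginary_unitN/imaginary_unit_i.
Qed.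

End Regularity.

Section Gap.
Context {R : realType} {A : cstarAlgType R} {E : hilbertModType A}.
Local Notation "<< x , y >>" := (iprod x y : A).
Implicit Types (t : operator E) (T : adjointable E E) (k : R[i]).
Implicit Types (S : set (E * E)) (p q r : E * E).

Lemma ipnorm_pair_le p : ipnorm p <= nrm p.1 + nrm p.2.
Proof.
rewrite -ler_sqr ?nnegrE ?addr_ge0 ?nrm_ge0 ?ipnorm_ge0//.
by rewrite ipnorm_sq nrm_iprodD_le.
Qed.

Lemma nrm_fst_le p : nrm p.1 <= ipnorm p.
Proof.
by rewrite -ler_sqr ?nnegrE ?nrm_ge0 ?ipnorm_ge0// ipnorm_sq nrm_le_iprodD.
Qed.

Lemma nrm_snd_le p : nrm p.2 <= ipnorm p.
Proof.
rewrite -ler_sqr ?nnegrE ?nrm_ge0 ?ipnorm_ge0// ipnorm_sq.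
by rewrite /iprod /= addrC nrm_le_iprodD.
Qed.

Lemma orth_proj_eq S p q : sa_graph S -> S q ->
  (forall r, S r -> << r, p - q >> = 0) -> orth_proj S p = q.
Proof.
move=> sS Sq pq; apply: xget_unique => // q' [Sq' pq'].
have Sd : S (q' - q) by exact: sa_graphB.
have d0 : << q' - q, q' - q >> = 0.
  have -> : << q' - q, q' - q >> = << q' - q, p - q >> - << q' - q, p - q' >>.
    by rewrite !iprodBr; linear_ring R.
  by rewrite pq// pq'// subrr.
have i0 : ipnorm (q' - q) = 0.
  by apply/eqP; rewrite -sqrf_eq0 ipnorm_sq d0 nrm0.
have h1 := nrm_fst_le (q' - q); have h2 := nrm_snd_le (q' - q).
rewrite i0 in h1 h2.
apply/eqP; rewrite -subr_eq0; apply/eqP.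
rewrite [LHS]surjective_pairing.
have -> : (q' - q).1 = 0 by apply: nrm_eq0; apply/le_anti; rewrite h1 nrm_ge0.
have -> // : (q' - q).2 = 0.
by apply: nrm_eq0; apply/le_anti; rewrite h2 nrm_ge0.
Qed.

(** The projection in terms of the two resolvents (t + i)^-1 and (t - i)^-1:
    with q = (a + b) / 2, the pair (p.2 - q.2, q.1 - p.1) is i (a - b) / 2,
    hence lies in the graph, and this says that p - q is orthogonal to the graph. *)
Lemma orth_proj_resolvents S p a b : sa_graph S -> S a -> S b ->
  a.2 + 'i%C *: a.1 = p.2 + 'i%C *: p.1 ->
  b.2 - 'i%C *: b.1 = p.2 - 'i%C *: p.1 ->
  orth_proj S p = 2^-1%:C%C *: (a + b).
Proof.
move=> sS Sa Sb ap bp; apply: orth_proj_eq => // [|r Sr].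
  by apply: sa_graphZ => //; exact: sa_graphD.
have a2 : a.2 = p.2 + 'i%C *: p.1 - 'i%C *: a.1 by rewrite -ap addrK.
have b2 : b.2 = p.2 - 'i%C *: p.1 + 'i%C *: b.1 by rewrite -bp subrK.
set q := _ *: (a + b).
have Sd : S (p.2 - q.2, q.1 - p.1).
  have -> : (p.2 - q.2, q.1 - p.1) = ('i%C * 2^-1%:C%C) *: (a - b).
    rewrite [RHS]surjective_pairing; congr pair; rewrite /q /= a2 b2.
      linear_ring R.
    linear_ring R using (@mulc_ii R).
  by apply: sa_graphZ => //; exact: sa_graphB.
have := sa_graph_sym sS Sr Sd; rewrite [LHS]/= [RHS]/= => h.
rewrite -[LHS]/(<< r.1, p.1 - q.1 >> + << r.2, p.2 - q.2 >>) h.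
by rewrite -opprB iprodNr addNr.
Qed.

(** Resolvent identity: (S + B1 + k) (a - b) = - (B1 - B2) b.1. *)
Lemma resolvent_diff_bd S (B1 B2 : E -> E) k (d : R) a b y :
  sa_graph S -> symmetric_map B1 -> symmetric_map B2 -> imaginary_unit k ->
  0 <= d -> (forall x, nrm (B1 x - B2 x) <= d * nrm x) ->
  graph_plus S B1 a -> graph_plus S B2 b ->
  a.2 + k *: a.1 = y -> b.2 + k *: b.1 = y ->
  nrm (a.1 - b.1) <= d * nrm y /\ nrm (a.2 - b.2) <= d * nrm y.
Proof.
move=> sS s1 s2 hk d0 Bd Sa Sb ay be.
pose b' : E * E := (b.1, b.2 + (B1 b.1 - B2 b.1)).
have Sb' : graph_plus S B1 b'.
  rewrite /graph_plus /=.
  by have -> : b.2 + (B1 b.1 - B2 b.1) - B1 b.1 = b.2 - B2 b.1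
    by linear_ring R.
have s1S := sa_graph_plus sS s1; have s2S := sa_graph_plus sS s2.
have := resolvent_bd1 s1S hk (sa_graphB s1S Sa Sb').
have -> : (a - b').2 + k *: (a - b').1 = - (B1 b.1 - B2 b.1).
  have -> : (a - b').2 + k *: (a - b').1 =
      (a.2 + k *: a.1) - (b.2 + k *: b.1) - (B1 b.1 - B2 b.1).
    by rewrite /=; linear_ring R.
  by rewrite ay be subrr sub0r.
rewrite nrmN => h.
have h1 : nrm (a.1 - b.1) <= d * nrm y.
  apply: (le_trans h); apply: (le_trans (Bd _)); rewrite ler_wpM2l//.
  by rewrite -be; exact: resolvent_bd1 s2S hk Sb.
split=> //; have -> : a.2 - b.2 = - (k *: (a.1 - b.1)).
  have -> : a.2 = y - k *: a.1 by rewrite -ay addrK.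
  have -> : b.2 = y - k *: b.1 by rewrite -be addrK.
  by linear_ring R.
by rewrite nrmN nrmZ (imaginary_unit_norm hk) mul1r.
Qed.

Lemma orth_proj_diff_bd S (B1 B2 : E -> E) (d : R) p :
  sa_graph S -> symmetric_map B1 -> symmetric_map B2 ->
  (forall k, imaginary_unit k ->
    shift_onto (graph_plus S B1) k /\ shift_onto (graph_plus S B2) k) ->
  0 <= d -> (forall x, nrm (B1 x - B2 x) <= d * nrm x) -> ipnorm p <= 1 ->
  ipnorm (orth_proj (graph_plus S B1) p - orth_proj (graph_plus S B2) p)
    <= 4 * d.
Proof.
move=> sS s1 s2 onto d0 Bd p1.
have [i1 i2] := onto _ imaginary_unit_i.
have uN : imaginary_unit (- 'i%C : R[i]).
  exact/imaginary_unitN/imaginary_unit_i.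
have [n1 n2] := onto _ uN.
set y := p.2 + 'i%C *: p.1; set z := p.2 + (- 'i%C) *: p.1.
have [[a Sa ay] [b Sb bz]] := (i1 y, n1 z).
have [[a' Sa' ay'] [b' Sb' bz']] := (i2 y, n2 z).
have s1S := sa_graph_plus sS s1; have s2S := sa_graph_plus sS s2.
rewrite (orth_proj_resolvents s1S Sa Sb ay); last by rewrite -!scaleNr.
rewrite (orth_proj_resolvents s2S Sa' Sb' ay'); last by rewrite -!scaleNr.
have bd k : imaginary_unit k -> d * nrm (p.2 + k *: p.1) <= d * 2.
  move=> hk; rewrite ler_wpM2l//; apply: (le_trans (nrmD _ _)).
  rewrite nrmZ (imaginary_unit_norm hk) mul1r.
  by have := nrm_fst_le p; have := nrm_snd_le p; lra.
have := bd _ imaginary_unit_i; have := bd _ uN; rewrite -/y -/z => zd yd.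
have [a1 a2] := resolvent_diff_bd sS s1 s2 imaginary_unit_i d0 Bd Sa Sa' ay ay'.
have [b1 b2] := resolvent_diff_bd sS s1 s2 uN d0 Bd Sb Sb' bz bz'.
have half (u u' v v' : E) : nrm (u - u') <= d * 2 -> nrm (v - v') <= d * 2 ->
    nrm (2^-1%:C%C *: (u + v) - 2^-1%:C%C *: (u' + v')) <= 2 * d.
  move=> hu hv.
  have -> : 2^-1%:C%C *: (u + v) - 2^-1%:C%C *: (u' + v') =
      2^-1%:C%C *: ((u - u') + (v - v')) by linear_ring R.
  rewrite nrmZ Re_norm_real ger0_norm//; have := nrmD (u - u') (v - v'); lra.
apply: (le_trans (ipnorm_pair_le _)) => /=.
have h1 := half _ _ _ _ (le_trans a1 yd) (le_trans b1 zd).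
have h2 := half _ _ _ _ (le_trans a2 yd) (le_trans b2 zd).
by apply: (le_trans (lerD h1 h2)); lra.
Qed.

Lemma ipnorm0 (F : innerProductModType A) : ipnorm (0 : F) = 0.
Proof. by apply/eqP; rewrite -sqrf_eq0 ipnorm_sq iprod0r nrm0. Qed.

Lemma opnorm_le (F G : innerProductModType A) (f : F -> G) (c : R) :
  (forall x, ipnorm x <= 1 -> ipnorm (f x) <= c) -> opnorm f <= c.
Proof.
move=> fc; apply: ge_sup; last by move=> _ [x x1 <-]; exact: fc.
by exists (ipnorm (f 0)), 0 => //=; rewrite ipnorm0.
Qed.

Lemma opnorm_ge0 (F G : innerProductModType A) (f : F -> G) : 0 <= opnorm f.
Proof.
rewrite /opnorm; set X := (X in sup X).
have [hX|nX] := pselect (has_sup X); last by rewrite sup_out.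
apply: (@le_trans _ _ (ipnorm (f 0))); first exact: ipnorm_ge0.
by apply: ub_le_sup; [case: hX|exists 0 => //=; rewrite ipnorm0].
Qed.

Lemma opnorm_bound (f : E -> E) (c : R) : (forall k x, f (k *: x) = k *: f x) ->
  (forall x, nrm (f x) <= c * nrm x) ->
  forall x, nrm (f x) <= opnorm f * nrm x.
Proof.
move=> fZ fc x; have [x0|x0] := eqVneq (nrm x) 0.
  by apply: (le_trans (fc x)); rewrite x0 !mulr0.
have x1 : 0 < nrm x by rewrite lt_neqAle eq_sym x0 nrm_ge0.
rewrite -ler_pdivrMr//.
have e : nrm (f ((nrm x)^-1%:C%C *: x)) = nrm (f x) / nrm x.
  by rewrite fZ nrmZ Re_norm_real ger0_norm ?invr_ge0 ?nrm_ge0// mulrC.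
rewrite -e -ipnormE; apply: ub_le_sup.
  exists `|c| => _ [z z1 <-]; rewrite /= ipnormE in z1 *; rewrite ipnormE.
  apply: (le_trans (fc z)).
  apply: (le_trans (ler_wpM2r (nrm_ge0 z) (ler_norm c))).
  by rewrite ler_piMr.
exists ((nrm x)^-1%:C%C *: x) => //=.
by rewrite ipnormE nrmZ Re_norm_real ger0_norm ?invr_ge0 ?nrm_ge0// mulVf.
Qed.

Theorem gap_add_bounded_le t T U : regular t -> selfadjoint t ->
  selfadjoint_bounded T -> selfadjoint_bounded U ->
  gap (add_bounded t T) (add_bounded t U) <= 4 * opnorm (fun x => T x - U x).
Proof.
move=> rt st sT sU; apply: opnorm_le => p p1; rewrite !graph_add_bounded.
apply: orth_proj_diff_bd => //.
- move=> k hk; rewrite -!graph_add_bounded.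
  by split; exact: shift_onto_add_bounded.
- exact: opnorm_ge0.
have [[c _ Tc] [d _ Ud]] := (adjointable_nrm T, adjointable_nrm U).
apply: (@opnorm_bound _ (c + d)) => [k x|x].
  by rewrite (linearZ_LR T) (linearZ_LR U) scalerBr.
by apply: (le_trans (nrmB _ _)); rewrite mulrDl lerD.
Qed.

End Gap.

(** * Adjointable operators and compactness of resolvents *)

Section Adjointables.
Context {R : realType} {A : cstarAlgType R} {E : hilbertModType A}.
Local Notation "<< x , y >>" := (iprod x y : A).
Implicit Types (S T U : adjointable E E) (k : R[i]).

Lemma adjointable_id : exists U, forall x, U x = x.
Proof.
by apply: (@adjointable_of_adjoint _ _ _ id id 1) => // x; rewrite mul1r.
Qed.

Lemma adjointable_comp S T : exists U, forall x, U x = S (T x).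
Proof.
have [[S' SS'] [T' TT']] := (adjointable_adjoint S, adjointable_adjoint T).
have [[c c0 Sc] [d d0 Td]] := (adjointable_nrm S, adjointable_nrm T).
apply: (@adjointable_of_adjoint _ _ _ (S \o T) (T' \o S') (c * d))
  => [x y|x] /=.
  by rewrite SS' TT'.
by rewrite -mulrA; apply: (le_trans (Sc _)); rewrite ler_pM2l.
Qed.

Lemma adjointable_lincomb k S T : exists U, forall x, U x = k *: S x + T x.
Proof.
have [[S' SS'] [T' TT']] := (adjointable_adjoint S, adjointable_adjoint T).
have [[c c0 Sc] [d d0 Td]] := (adjointable_nrm S, adjointable_nrm T).
apply: (@adjointable_of_adjoint _ _ _ (fun x => k *: S x + T x)
  (fun y => conjc k *: S' y + T' y) (complex.Re `|k| * c + d)) => [x y|x].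
  by rewrite iprodDl iprodZl SS' TT' iprodDr iprodZr.
apply: (le_trans (nrmD _ _)); rewrite nrmZ mulrDl lerD// -mulrA.
by rewrite ler_wpM2l ?Re_norm_ge0.
Qed.

Lemma compact_op_comp_adjointable (f : E -> E) S :
  compact_op f -> compact_op (fun x => f (S x)).
Proof.
have [S' SS'] := adjointable_adjoint S; have [c c0 Sc] := adjointable_nrm S.
apply: (compact_op_comp_right (f' := S') c0) => [x y|x].
  by rewrite -iprodC SS' iprodC.
by rewrite !ipnormE.
Qed.

Lemma compact_opZ k (f : E -> E) :
  compact_op f -> compact_op (fun x => k *: f x).
Proof.
move=> cf; have [Id IdE] := adjointable_id.
have [kI kIE] := adjointable_lincomb (k - 1) Id Id.
apply: compact_op_ext (compact_op_comp_left kI cf) => x.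
by rewrite kIE IdE scalerBl scale1r subrK.
Qed.

Lemma graph_bounded_operator T p :
  graph (bounded_operator T) p <-> p.2 = T p.1.
Proof.
split=> [[x _ <-] //|pT].
exists (exist _ p.1 (erefl : p.1 \in full_dom)) => //.
by case: p pT => x y /= ->.
Qed.

(** A densely defined restriction of a bounded operator is closable with that
    operator as its closure. *)
Lemma closure_eq1_of_bounded (G : set (E * E)) T : dense (fst @` G) ->
  (forall p, G p -> p.2 = T p.1) -> compact_op (fun x => T x - x) ->
  closure_eq1_mod_compact G.
Proof.
move=> /dense_nrm dG GT cT; have [c c0 Tc] := adjointable_nrm T.
have clT p : closure G p -> p.2 = T p.1.
  move=> /closure_nrm cp; apply/eqP; rewrite -subr_eq0.
  apply/eqP/nrm_le_eq0 => e e0.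
  have c1 : 0 < c + 1 by lra.
  have [q Gq [q1 q2]] := cp _ (divr_gt0 e0 c1).
  have -> : p.2 - T p.1 = (p.2 - q.2) - T (p.1 - q.1).
    by rewrite (linearB T) (GT _ Gq); linear_ring R.
  apply: (le_trans (nrmB _ _)); apply: (le_trans (lerD (ltW q2) (Tc _))).
  apply: (le_trans (lerD (lexx _) (ler_wpM2l (ltW c0) (ltW q1)))).
  have -> : e / (c + 1) + c * (e / (c + 1)) = e by field; lra.
  exact: lexx.
split; first by move=> y /clT /=; rewrite linear0.
exists T; split=> //; apply/seteqP.
split=> [p /clT pT|p /graph_bounded_operator pT].
  exact/graph_bounded_operator.
apply/closure_nrm => e e0; have c1 : 0 < c + 1 by lra.
have [_ [q Gq <-] xq] := dG p.1 _ (divr_gt0 e0 c1); exists q => //.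
rewrite ltr_pdivlMr// in xq; have n0 := nrm_ge0 (p.1 - q.1).
split; first by nra.
rewrite pT (GT _ Gq) -linearB; apply: (le_lt_trans (Tc _)); nra.
Qed.

End Adjointables.

Section Resolvents.
Context {R : realType} {A : cstarAlgType R} {E : hilbertModType A}.
Local Notation "<< x , y >>" := (iprod x y : A).
Variables (t : operator E) (k : R[i]).
Hypotheses (rt : regular t) (st : selfadjoint t) (hk : imaginary_unit k).

(** This says that r = (t + k)^-1 and s = (t - k)^-1, and that they are adjoint
    to each other. *)
Definition resolvents (r s : E -> E) :=
  [/\ forall y, graph t (r y, y - k *: r y),
      forall y, graph t (s y, y + k *: s y) &
      forall x y, << r x, y >> = << x, s y >>].

Lemma resolvents_exist : exists r s : adjointable E E, resolvents r s.
Proof.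
have onto j : imaginary_unit j ->
    exists r : E -> E, forall y, graph t (r y, y - j *: r y).
  move=> hj; suff /choice[r rP] : forall y, exists z, graph t (z, y - j *: z).
    by exists r.
  move=> y.
  have [p Sp <-] := regular_shift_onto rt st hj y; exists p.1.
  by rewrite addrK; case: p Sp.
have [r rP] := onto k hk; have [s sP] := onto _ (imaginary_unitN hk).
have {}sP y : graph t (s y, y + k *: s y).
  by have := sP y; rewrite scaleNr opprK.
have [ck _] := hk.
have rs x y : << r x, y >> = << x, s y >>.
  have /= := sa_graph_sym st (rP x) (sP y).
  rewrite iprodBl iprodDr iprodZl iprodZr ck scaleNr opprK.
  by move=> /addIr.
have sr x y : << s x, y >> = << x, r y >> by rewrite -iprodC -rs iprodC.
have rb x : nrm (r x) <= 1 * nrm x.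
  by have /= := resolvent_bd1 st hk (rP x); rewrite subrK mul1r.
have sb x : nrm (s x) <= 1 * nrm x.
  have /= := resolvent_bd1 st (imaginary_unitN hk) (sP x).
  by rewrite scaleNr addrK mul1r.
have [r' r'E] := adjointable_of_adjoint rs rb.
have [s' s'E] := adjointable_of_adjoint sr sb.
exists r', s'; split=> [y|y|x y]; rewrite ?r'E ?s'E//.
Qed.

Lemma resolvents_inv (r s : E -> E) x w : resolvents r s -> graph t (x, w) ->
  r (w + k *: x) = x.
Proof.
move=> [rP _ _] Sx; apply/eqP; rewrite -subr_eq0; apply/eqP/nrm_eq0.
apply/le_anti; rewrite nrm_ge0 andbT.
have /= := resolvent_bd1 st hk (sa_graphB st (rP (w + k *: x)) Sx).
move=> /le_trans; apply; set u := _ + k *: (_ - _).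
by have -> : u = 0 by [rewrite /u; linear_ring R]; rewrite nrm0.
Qed.

(** The resolvent maps E to the graph module of t, boundedly and with an
    adjoint, so it turns t-compact operators into compact ones. *)
Lemma compact_op_resolvent (r s : adjointable E E) (B : adjointable E E) :
  resolvents r s -> relatively_compact t (bounded_operator B) ->
  compact_op (fun x => B (r x)).
Proof.
move=> [rP sP rs] [sub cB]; have [ck _] := hk.
have /choice[f fP] : forall z, exists x : graph_module t,
    \val x = r z /\ t x = z - k *: r z.
  by move=> z; have [x _ [xr tx]] := rP z; exists x.
have {}cB : compact_op (fun x : graph_module t => B (\val x)).
  exact: compact_op_ext cB.
have : compact_op (fun z => B (\val (f z))).
  apply: (@compact_op_comp_right _ _ E (graph_module t) E f
    (fun w => s (\val w) + t w + k *: s (t w)) 2 _ _ _ _ cB) => // [z w|z].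
    have [fr tf] := fP z.
    have -> : iprod w (f z) = << \val w, r z >> + << t w, z - k *: r z >>.
      by rewrite -tf -fr.
    have sr x y : << s x, y >> = << x, r y >> by rewrite -iprodC -rs iprodC.
    rewrite !iprodDl iprodZl !sr ck iprodBr iprodZr; linear_ring R.
  have [fr tf] := fP z.
  rewrite ipnormE -ler_sqr ?nnegrE ?mulr_ge0 ?nrm_ge0 ?ipnorm_ge0// ipnorm_sq.
  have -> : iprod (f z) (f z) =
      << r z, r z >> + << z - k *: r z, z - k *: r z >>.
    by rewrite -tf -fr.
  apply: (le_trans (nrm_iprodD_le _ _)).
  have /= := resolvent_bd1 st hk (rP z); have /= := resolvent_bd2 st hk (rP z).
  rewrite subrK; have := nrm_ge0 (r z); have := nrm_ge0 (z - k *: r z).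
  move: (nrm (r z)) (nrm (z - k *: r z)) (nrm z) => a b c a0 b0 h1 h2.
  by rewrite ler_sqr ?nnegrE; lra.
by apply: compact_op_ext => z; have [-> _] := fP z.
Qed.

End Resolvents.

(** * Fredholm operators and the path t + B *)

Section Fredholm.
Context {R : realType} {A : cstarAlgType R} {E : hilbertModType A}.
Local Notation "<< x , y >>" := (iprod x y : A).
Variables (t : operator E) (T : adjointable E E).
Hypotheses (rt : regular t) (st : selfadjoint t).
Hypotheses (sT : selfadjoint_bounded T).
Hypotheses (cT : relatively_compact t (bounded_operator T)).

Local Notation i := ('i%C : R[i]).
Let hi : imaginary_unit i := imaginary_unit_i.

Lemma dense_dom_add_bounded : dense (fst @` graph (add_bounded t T)).
Proof. by have [_ ] := regular_add_bounded rt st sT. Qed.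

Lemma graph_fun x y z : graph t (x, y) -> graph t (x, z) -> y = z.
Proof.
move=> [u _ [ux <-]] [v _ [vx <-]]; congr (t _).
by apply: val_inj; exact: etrans ux (esym vx).
Qed.

(** With G t = 1 + K on D(t), the operator Q = 1 + i G is a left inverse of
    t (t + i)^-1 = 1 - i (t + i)^-1 modulo compacts, and Q (t + i)^-1 is a
    pseudo left inverse of t; it also is one of t + T because (t + i)^-1 T is
    the adjoint of the compact operator T (t - i)^-1. *)
Lemma pseudo_left_inverse_add_bounded (G : adjointable E E) :
  pseudo_left_inverse t G ->
  exists G', pseudo_left_inverse (add_bounded t T) G'.
Proof.
move=> [_ [B [clB cB]]].
have BG x w : graph t (x, w) -> G w = B x.
  move=> Sx.
  have /graph_bounded_operator // : graph (bounded_operator B) (x, G w).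
  rewrite -clB; apply: subset_closure; exists w => //=.
  exact/graph_bounded_operator.
have [r [s rs]] := resolvents_exist rt st hi.
have [rP sP rsP] := rs.
have [Id IdE] := @adjointable_id _ _ E.
have [Q QE] := adjointable_lincomb i G Id.
have [G' G'E] := adjointable_comp Q r; exists G'.
have [K KE] := adjointable_lincomb (-1) Id B.
have [Kr KrE] := adjointable_comp K r.
have [rT rTE] := adjointable_comp r T.
have [QrT QrTE] := adjointable_comp Q rT.
have [W0 W0E] := adjointable_lincomb i Kr QrT.
(* On D(t), G' (t + T) is the restriction of
   W = 1 + i K (t + i)^-1 + Q (t + i)^-1 T with K = B - 1. *)
have [W WE] := adjointable_lincomb 1 W0 Id.
apply: (@closure_eq1_of_bounded _ _ _ _ W).
- suff -> :
      fst @` (graph (bounded_operator G') \; graph (add_bounded t T))%relation =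
      fst @` graph (add_bounded t T) by exact: dense_dom_add_bounded.
  apply/seteqP; split=> y [[x w]].
    by move=> [z xz _] <-; exists (x, z).
  move=> xw <-; exists (x, G' w) => //; exists w => //.
  exact/graph_bounded_operator.
- move=> [x y] [w xw /graph_bounded_operator /= ->].
  have := xw; rewrite graph_add_bounded /graph_plus /= => xw0.
  have rw0 : r (w - T x) = x - i *: r x.
    have := resolvents_inv st hi rs xw0; rewrite linearD (linearZ_LR r) => rx.
    by apply/eqP; rewrite eq_sym subr_eq rx.
  have rw1 : r w = x - i *: r x + r (T x).
    by rewrite -rw0 (linearB r) subrK.
  rewrite G'E rw1 (linearD Q) QE (BG _ _ (rP x)) IdE.
  rewrite WE W0E KrE KE QrTE rTE !IdE; linear_ring R.
apply: (@compact_op_ext _ _ _ _ (fun x => i *: K (r x) + Q (r (T x)))) => [x|].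
  by rewrite WE W0E KrE QrTE rTE IdE; linear_ring R.
apply: compact_opD.
  apply: compact_opZ; apply: compact_op_comp_adjointable.
  by apply: compact_op_ext cB => x; rewrite KE IdE; linear_ring R.
apply: compact_op_comp_left.
apply: (@compact_op_adjoint _ _ _ (fun x => T (s x))).
  by move=> x y; rewrite sT -iprodC -rsP iprodC.
have sr : resolvents t (- i) s r.
  split=> [y|y|x y]; rewrite ?scaleNr ?opprK//.
  by rewrite -iprodC -rsP iprodC.
have := compact_op_resolvent st (imaginary_unitN hi) sr cT; exact.
Qed.

(** Symmetrically, t G = 1 + K with G mapping E into D(t), Q = 1 + i G is a
    right inverse of t (t + i)^-1 modulo compacts, and (t + i)^-1 Q is a pseudo right
    inverse of t + T because T (t + i)^-1 is compact. *)
Lemma pseudo_right_inverse_add_bounded (G : adjointable E E) :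
  pseudo_right_inverse t G ->
  exists G', pseudo_right_inverse (add_bounded t T) G'.
Proof.
move=> [_ [B [clB cB]]].
have GB x : graph t (G x, B x).
  apply: (sa_graph_closed st); apply/closure_nrm => e e0.
  have [c c0 Gc] := adjointable_nrm G; have c1 : 0 < c + 1 by lra.
  have /closure_nrm cl :
      closure (graph t \; graph (bounded_operator G))%relation (x, B x).
    by rewrite clB; apply/graph_bounded_operator.
  have [[x' y] [z /graph_bounded_operator /= -> zy] [/= q1 q2]] :=
    cl _ (divr_gt0 e0 c1).
  exists (G x', y) => //=; rewrite -(linearB G).
  have n0 := nrm_ge0 (x - x'); rewrite !ltr_pdivlMr// in q1 q2.
  split; first by apply: (le_lt_trans (Gc _)); nra.
  by have := nrm_ge0 (B x - y); nra.
have [r [s rs]] := resolvents_exist rt st hi.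
have [rP sP rsP] := rs.
have [Id IdE] := @adjointable_id _ _ E.
have [Q QE] := adjointable_lincomb i G Id.
have [G' G'E] := adjointable_comp r Q; exists G'.
have [K KE] := adjointable_lincomb (-1) Id B.
have [rK rKE] := adjointable_comp r K.
have [Tr TrE] := adjointable_comp T r.
have [TrQ TrQE] := adjointable_comp Tr Q.
have [W0 W0E] := adjointable_lincomb i rK TrQ.
(* (t + T) G' = W = 1 + i (t + i)^-1 K + T (t + i)^-1 Q with K = B - 1. *)
have [W WE] := adjointable_lincomb 1 W0 Id.
have tG' x : graph (add_bounded t T) (G' x, W x).
  rewrite graph_add_bounded /graph_plus /=.
  have -> : W x - T (G' x) = Q x - i *: r (Q x); last by rewrite G'E.
  have Gx := resolvents_inv st hi rs (GB x).
  rewrite linearD (linearZ_LR r) in Gx.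
  have irG : i *: r (G x) = G x - r (B x).
    by apply/eqP; rewrite eq_sym subr_eq addrC Gx.
  have rQ : r (Q x) = G x - r (B x) + r x.
    by rewrite QE IdE (linearD r) (linearZ_LR r) irG.
  rewrite WE W0E rKE KE TrQE TrE G'E !IdE (linearD r) (linearZ_LR r) rQ QE IdE.
  linear_ring R.
apply: (@closure_eq1_of_bounded _ _ _ _ W).
- apply/dense_nrm => x e e0; exists x; last by rewrite subrr nrm0.
  exists (x, W x) => //; exists (G' x) => //.
  exact/graph_bounded_operator.
- move=> [x y] [z /graph_bounded_operator /= -> zy].
  have := tG' x; move: zy; rewrite graph_add_bounded => h1 h2.
  by have /addIr := graph_fun h1 h2.
apply: (@compact_op_ext _ _ _ _ (fun x => i *: r (K x) + T (r (Q x)))) => [x|].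
  by rewrite WE W0E rKE TrQE TrE IdE; linear_ring R.
apply: compact_opD.
  apply: compact_opZ; apply: compact_op_comp_left.
  by apply: compact_op_ext cB => x; rewrite KE IdE; linear_ring R.
apply: (@compact_op_comp_adjointable _ _ _ (fun x => T (r x))).
have := compact_op_resolvent st hi rs cT; exact.
Qed.

End Fredholm.

Lemma fredholm_add_bounded {R : realType} {A : cstarAlgType R}
    {E : hilbertModType A} (t : operator E) (T : adjointable E E) :
  regular t -> selfadjoint t -> selfadjoint_bounded T ->
  relatively_compact t (bounded_operator T) -> fredholm t ->
  fredholm (add_bounded t T).
Proof.
move=> rt st sT cT [[G lG] [H rH]]; split.
  exact: pseudo_left_inverse_add_bounded lG.
exact: pseudo_right_inverse_add_bounded rH.
Qed.

Unset Implicit Arguments.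

Theorem theorem3p14 (R : realType) (A : cstarAlgType R) (E : hilbertModType A)
    (t : operator E) (I : interval R) (B : R -> adjointable E E)
    (t_regular : regular t) (t_selfadjoint : selfadjoint t)
    (t_fredholm : fredholm t)
    (B_selfadjoint : forall l, l \in I -> selfadjoint_bounded (B l))
    (B_continuous : forall l, l \in I ->
      opnorm (fun x : E => B m x - B l x) @[m --> within [set` I] (nbhs l)]
        --> (0 : R))
    (B_compact : forall l, l \in I ->
      relatively_compact t (bounded_operator (B l))) :
  (forall l, l \in I ->
    [/\ regular (add_bounded t (B l)), selfadjoint (add_bounded t (B l)) &
        fredholm (add_bounded t (B l))]) /\
  (forall l, l \in I ->
    gap (add_bounded t (B m)) (add_bounded t (B l))
      @[m --> within [set` I] (nbhs l)] --> (0 : R)).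
Proof.
split=> l lI.
  split.
  - exact: regular_add_bounded (B_selfadjoint l lI).
  - exact: selfadjoint_add_bounded (B_selfadjoint l lI).
  - apply: fredholm_add_bounded t_fredholm => //; first exact: B_selfadjoint.
    exact: B_compact.
apply: (@squeeze_cvgr _ _ _ _ (fun=> 0)
  (fun m => 4 * opnorm (fun x => B m x - B l x))).
- near=> m; rewrite opnorm_ge0 /=.
  have mI : m \in I by near: m; exact: withinT.
  exact: gap_add_bounded_le (B_selfadjoint m mI) (B_selfadjoint l lI).
- exact: cvg_cst.
- rewrite -(mulr0 4); apply: cvgM; [exact: cvg_cst|exact: B_continuous].
Unshelve. all: by end_near. Qed.
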